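(* Let $\alpha>1/2$ and let $\boldsymbol{\gamma}=(\gamma_u)_{u\subset\mathbb{N},|u|<\infty}$ be a collection of non-negative weights with $\gamma_\emptyset=1$. If there exists $\lambda\in(1/\alpha,2)$ such that $$\sum_{\substack{u\subset\mathbb{N}\\|u|<\infty}}\gamma_u^\lambda(2\zeta(\alpha\lambda))^{|u|}<\infty,$$ where $\zeta$ is the Riemann zeta function, then the multivariate approximation problem in the weighted Korobov spaces $H_{d,\alpha,\boldsymbol{\gamma}}$, $d\in\mathbb{N}$, is strongly polynomially tractable both in the deterministic $L_\infty$ sense and in the randomized $L_2$ sense.
   Context: **Weighted Korobov space.** For $\boldsymbol{k}\in\mathbb{Z}^d$ let $u=\mathrm{supp}(\boldsymbol{k})=\{j\in\{1,\ldots,d\}\mid k_j\ne0\}$ and $r_{\alpha,\boldsymbol{\gamma}}(\boldsymbol{k})=\frac{1}{\gamma_u}\prod_{j\in u}|k_j|^\alpha$ (empty product $=1$; if $\gamma_u=0$, then $r_{\alpha,\boldsymbol{\gamma}}(\boldsymbol{k})=+\infty$ and $\widehat f(\boldsymbol{k})=0$ is required). $H_{d,\alpha,\boldsymbol{\gamma}}$ is the space of continuous functions $f$ on $[0,1]^d$, 1-periodic in each variable, with finite norm $\|f\|_{d,\alpha,\boldsymbol{\gamma}}=\big(\sum_{\boldsymbol{k}\in\mathbb{Z}^d}r_{\alpha,\boldsymbol{\gamma}}^2(\boldsymbol{k})|\widehat f(\boldsymbol{k})|^2\big)^{1/2}$, where $\widehat f(\boldsymbol{k})=\int_{[0,1]^d}f(\boldsymbol{x})e^{-2\pi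 i\boldsymbol{k}\cdot\boldsymbol{x}}\,\mathrm{d}\boldsymbol{x}$ (terms with $\gamma_u=0$ are omitted). **Errors.** A deterministic algorithm using $N$ function evaluations is a map $f\mapsto A_N(f)=\varphi(f(\boldsymbol{x}_1),\ldots,f(\boldsymbol{x}_N))$ with points $\boldsymbol{x}_1,\ldots,\boldsymbol{x}_N\in[0,1]^d$ and a map $\varphi$ into functions on $[0,1]^d$; its worst-case $L_\infty$ error is $\sup_{\|f\|_{d,\alpha,\boldsymbol{\gamma}}\le1}\sup_{\boldsymbol{x}\in[0,1]^d}|f(\boldsymbol{x})-A_N(f)(\boldsymbol{x})|$. A randomized algorithm using $N$ function evaluations is a random choice $A_{N,\omega}$ of such an algorithm (measurable in the random element $\omega$); its worst-case root mean squared $L_2$ error is $\sup_{\|f\|_{d,\alpha,\boldsymbol{\gamma}}\le1}\big(\mathbb{E}_\omega\|f-A_{N,\omega}(f)\|_{L_2([0,1]^d)}^2\big)^{1/2}$. **Tractability.** The information complexity $N(\varepsilon,d)$ is the minimal number of function evaluations required to reduce the worst-case error to at most $\varepsilon\in(0,1)$ for the $d$-dimensional problem (worst-case $L_\infty$ error over deterministic algorithms for the deterministic $L_\infty$ sense; worst-case root mean squared $L_2$ error over randomized algorithms for the randomized $L_2$ sense). The problem is strongly polynomially tractable if there are constants $C>0$ and $p\ge0$, independent of $\varepsilon$ and $d$, with $N(\varepsilon,d)\le C\varepsilon^{-p}$ for all $\varepsilon\in(0,1)$ and $d\in\mathbb{N}$. *)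

(* Defs.v *)
From HB Require Import structures.
From mathcomp Require Import all_boot all_order all_algebra.
From mathcomp Require Import finmap.
From mathcomp Require Import all_classical all_reals all_analysis.
From mathcomp Require Import complex.

Set Implicit Arguments.
Unset Strict Implicit.
Unset Printing Implicit Defensive.

Import Order.TTheory GRing.Theory Num.Theory.
Import numFieldNormedType.Exports.

Local Open Scope classical_set_scope.
Local Open Scope ring_scope.

(* Points of R^d are tuples, whose product sigma-algebra is canonical.
   Coordinates, and hence the elements of the index sets u of the weights,
   are numbered from 0: the coordinate set {1, .., d} is {0, .., d - 1} here,
   and the finite sets u of natural numbers are elements of {fset nat}. *)

Section Cube.
Context {R : realType}.

Definition unit_cube (d : nat) : set (d.-tuple R) :=
  [set x | forall j : 'I_d, 0 <= tnth x j <= 1].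

Definition tuple_cons (d : nat) (p : measurableTypeR R * d.-tuple R)
    : d.+1.-tuple R :=
  [tuple of p.1 :: p.2].

Lemma measurable_tuple_cons (d : nat) :
  measurable_fun [set: measurableTypeR R * d.-tuple R] (@tuple_cons d).
Proof.
apply: measurable_cons; last exact: measurable_snd.
exact: (@measurable_fst _ _ (measurableTypeR R) (d.-tuple R)).
Qed.

HB.instance Definition _ (d : nat) :=
  isMeasurableFun.Build _ _ _ _ (@tuple_cons d) (@measurable_tuple_cons d).

(* Lebesgue measure on [0, 1]^d, as the d-fold product of the uniform
   distribution on [0, 1]; for d = 0 it is the unit mass at the only point. *)
Fixpoint cube_measure (d : nat) : probability (d.-tuple R) R :=
  match d with
  | 0 => \d_([tuple] : 0.-tuple R)
  | d'.+1 =>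
      distribution (uniform_prob (@ltr01 R) \x cube_measure d')%E
        (@tuple_cons d')
  end.

End Cube.

Arguments unit_cube {R} d.

Section Korobov.
Context {R : realType}.

Definition zeta (s : R) : R :=
  limn (fun n => \sum_(1 <= m < n.+1) (m%:R `^ (- s))).

Definition expi (t : R) : R[i] := Complex (cos t) (sin t).

Definition fourier_coef (d : nat) (f : d.-tuple R -> R[i]) (k : d.-tuple int)
    : R[i] :=
  let g x :=
    f x * expi (- (2 * pi * \sum_(j < d) (tnth k j)%:~R * tnth x j)) in
  Complex (\int[cube_measure d]_(x in unit_cube d) complex.Re (g x))
          (\int[cube_measure d]_(x in unit_cube d) complex.Im (g x)).

Definition supp (d : nat) (k : d.-tuple int) : {fset nat} :=
  [fset val j | j in 'I_d & tnth k j != 0]%fset.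

Definition korobov_r (alpha : R) (gamma : {fset nat} -> R) (d : nat)
    (k : d.-tuple int) : \bar R :=
  if gamma (supp k) == 0 then +oo%E
  else ((gamma (supp k))^-1 *
        \prod_(j < d | tnth k j != 0) `|(tnth k j)%:~R| `^ alpha)%:E.

Definition korobov_norm (alpha : R) (gamma : {fset nat} -> R) (d : nat)
    (f : d.-tuple R -> R[i]) : \bar R :=
  sqrte (\esum_(k in [set k : d.-tuple int | gamma (supp k) != 0%R])
           (korobov_r alpha gamma k ^+ 2 *
            (Normc.normc (fourier_coef f k) ^+ 2)%:E))%E.

Definition continuous_tuple (d : nat) (f : d.-tuple R -> R[i]) : Prop :=
  let F (v : 'rV[R]_d) := f [tuple v ord0 j | j < d] in
  continuous (fun v => complex.Re (F v)) /\
  continuous (fun v => complex.Im (F v)).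

Definition periodic1 (d : nat) (f : d.-tuple R -> R[i]) : Prop :=
  forall (x : d.-tuple R) (j : 'I_d),
    f [tuple tnth x i + (i == j)%:R | i < d] = f x.

(* A continuous function on [0, 1]^d that is 1-periodic in each variable is
   represented by its unique periodic extension to R^d. *)
Definition korobov_space (alpha : R) (gamma : {fset nat} -> R) (d : nat)
    : set (d.-tuple R -> R[i]) :=
  [set f | [/\ continuous_tuple f,
               periodic1 f,
               forall k, gamma (supp k) = 0 -> fourier_coef f k = 0
             & (korobov_norm alpha gamma f < +oo)%E]].

Definition korobov_ball (alpha : R) (gamma : {fset nat} -> R) (d : nat)
    : set (d.-tuple R -> R[i]) :=
  [set f | korobov_space alpha gamma f /\ (korobov_norm alpha gamma f <= 1)%E].

End Korobov.

Arguments korobov_space {R} alpha gamma d.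
Arguments korobov_ball {R} alpha gamma d.

Section Algorithms.
Context {R : realType}.

Record det_algorithm (N d : nat) := DetAlgorithm {
  nodes : N.-tuple (d.-tuple R) ;
  nodes_in_cube : forall j : 'I_N, unit_cube d (tnth nodes j) ;
  reconstruct : N.-tuple R[i] -> d.-tuple R -> R[i] }.

Definition run (N d : nat) (A : det_algorithm N d) (f : d.-tuple R -> R[i])
    : d.-tuple R -> R[i] :=
  reconstruct A (map_tuple f (nodes A)).

Definition det_Linfty_error (alpha : R) (gamma : {fset nat} -> R) (N d : nat)
    (A : det_algorithm N d) : \bar R :=
  ereal_sup
    [set ereal_sup [set (Normc.normc (f x - run A f x))%:E | x in unit_cube d]
    | f in korobov_ball alpha gamma d].

(* Measurability in omega means that the random nodes are measurable and that,
   for each f in the space, (omega, x) |-> A_omega(f)(x) is jointly measurable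
   on Omega x [0, 1]^d. *)
Record rand_algorithm (alpha : R) (gamma : {fset nat} -> R) (N d : nat) :=
  RandAlgorithm {
    rand_disp : measure_display ;
    rand_space : measurableType rand_disp ;
    rand_prob : probability rand_space R ;
    realization : rand_space -> det_algorithm N d ;
    measurable_nodes :
      measurable_fun [set: rand_space] (fun w => nodes (realization w)) ;
    measurable_output : forall f, korobov_space alpha gamma d f ->
      measurable_fun ([set: rand_space] `*` unit_cube d)
        (fun p => complex.Re (run (realization p.1) f p.2)) /\
      measurable_fun ([set: rand_space] `*` unit_cube d)
        (fun p => complex.Im (run (realization p.1) f p.2)) }.

Arguments realization {alpha gamma N d} r _.

Definition L2_norm (d : nat) (g : d.-tuple R -> R[i]) : \bar R :=
  sqrte (\int[cube_measure d]_(x in unit_cube d) (Normc.normc (g x) ^+ 2)%:E)%E.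

Definition rand_L2_error (alpha : R) (gamma : {fset nat} -> R) (N d : nat)
    (A : rand_algorithm alpha gamma N d) : \bar R :=
  ereal_sup
    [set sqrte (\int[rand_prob A]_w
           (L2_norm (fun x => (f x - run (realization A w) f x)%R)) ^+ 2)%E
    | f in korobov_ball alpha gamma d].

(* The information complexities are +oo when no number of evaluations is
   enough; otherwise the infimum of a set of naturals is its minimum. *)
Definition det_Linfty_complexity (alpha : R) (gamma : {fset nat} -> R)
    (eps : R) (d : nat) : \bar R :=
  ereal_inf [set (N%:R)%:E | N in [set N : nat |
    exists A : det_algorithm N d,
      (det_Linfty_error alpha gamma A <= eps%:E)%E]].

Definition rand_L2_complexity (alpha : R) (gamma : {fset nat} -> R)
    (eps : R) (d : nat) : \bar R :=
  ereal_inf [set (N%:R)%:E | N in [set N : nat |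
    exists A : rand_algorithm alpha gamma N d,
      (rand_L2_error A <= eps%:E)%E]].

Definition strongly_polynomially_tractable (complexity : R -> nat -> \bar R)
    : Prop :=
  exists C p : R, [/\ 0 < C, 0 <= p &
    forall (eps : R) (d : nat), 0 < eps < 1 -> (0 < d)%N ->
      (complexity eps d <= (C * eps `^ (- p))%:E)%E].

End Algorithms.

(* Main.v *)
(** A rank-1 lattice whose generator separates the frequencies of a finite set
    [A] aliases each frequency outside [A] to at most one frequency of [A], so
    the lattice algorithm on [A] has an error of at most twice the sum of the
    moduli of the Fourier coefficients outside [A].  Put
    [weight k = r(k)^(-lambda)]; in every dimension these weights have a sum of
    at most the value [S] of the given series.  For [A = {k | delta <= weight k}]
    and [f] in the unit ball, the sum of the moduli of the coefficients outside
    [A] is at most [sqrt (S delta^(2/lambda - 1))], while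
    [#|A|] and the frequencies in [A] are at most [S / delta], so that a
    separating generator exists for [N <= 3 (S / delta)^3] nodes.  The function
    is recovered pointwise from its Fourier coefficients by Fejer means, which
    converge by Korovkin's argument.  The resulting algorithm is deterministic,
    hence randomized, and its L2 error is at most its uniform error. *)
Require Import Defs.
From mathcomp Require Import all_boot all_order all_algebra.
From mathcomp Require Import finmap.
From mathcomp Require Import all_classical all_reals all_analysis.
From mathcomp Require Import measurable_realfun complex ring lra zify.

Set Implicit Arguments.
Unset Strict Implicit.
Unset Printing Implicit Defensive.

Import Order.TTheory GRing.Theory Num.Theory.
Import numFieldNormedType.Exports.
Local Open Scope classical_set_scope.
Local Open Scope ring_scope.

(** * Trigonometric integrals over the cube *)

Section TrigonometricIntegrals.
Context {R : realType}.
Local Notation mu := (@lebesgue_measure R).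

(** The Fourier series of [f] is never summed. A Fejer mean is a finite trigonometric polynomial,
    and the reconstruction is linear and sees only [N] values. The error bound is therefore proved
    for the mean and passed to the limit at [x] and at the [N] nodes, so that only finite lists of
    Fourier coefficients occur. The mean is kept as a sum over pairs (a, b) of frequency vectors,
    with the coefficient at a - b: for fixed a the differences are distinct, so averaging over a
    loses nothing in the tail bound. The weight w = r^(-lambda) serves two purposes. For each
    support its sum factors over the coordinates, the one-dimensional sums converging because lambda
    > 1/alpha; and r^(-2) = w w^(2/lambda - 1), where lambda < 2 makes the second factor small on
    the tail. The factor 2 in the error is one unit for a missing frequency and one for its alias.
    Uniformity in d holds because the supports in dimension d are among the finite sets of the
    series. The resulting exponent is 6 lambda / (2 - lambda). *)

Definition phase (d : nat) (k : d.-tuple int) (x : d.-tuple R) : R :=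
  2 * pi * \sum_(j < d) (tnth k j)%:~R * tnth x j.

Lemma cosD2piz (x : R) (z : int) : cos (x + 2 * pi * z%:~R) = cos x.
Proof.
have H n y : cos (y + 2 * pi * n%:R) = cos y :> R.
  have -> : 2 * pi * n%:R = (pi *+ 2) *+ n :> R by rewrite mulr_natr mulr_natl.
  exact: (periodicn (@cosD2pi R)).
case: (intP z) => [|n|n]; first by rewrite mulr0 addr0.
  exact: (H n.+1).
rewrite -(H n.+1 (x + _)); congr cos; rewrite mulrNz -pmulrn; ring.
Qed.

Lemma sinD2piz (x : R) (z : int) : sin (x + 2 * pi * z%:~R) = sin x.
Proof. by rewrite -!cosBpihalf addrAC cosD2piz. Qed.

Lemma is_derive_sin_lin (a b t : R) :
  is_derive t (1 : R) (fun t : R => sin (a * t + b)) (a * cos (a * t + b)).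
Proof.
have H1 : is_derive t (1 : R) (fun t : R => a * t + b) a.
  have := is_deriveD (is_deriveZ a (is_derive_id t (1 : R))) (is_derive_cst b t (1 : R)).
  by rewrite addr0 /GRing.scale /= mulr1.
have := @is_derive1_comp _ (@sin R) (fun t => a * t + b) t _ _
  (is_derive_sin (a * t + b)) H1.
by rewrite mulrC.
Qed.

Lemma continuous_cos_lin (a b : R) : continuous (fun t : R => cos (a * t + b)).
Proof.
move=> t; apply: continuous_comp; last exact: continuous_cos.
by apply: cvgD; [apply: cvgMr; exact: cvg_id|exact: cvg_cst].
Qed.

Lemma derivable_oo_LRcontinuous_derivable (F : R -> R) (a b : R) :
  (forall x, derivable F x 1) -> derivable_oo_LRcontinuous F a b.
Proof.
move=> dF.
have cF x : {for x, continuous F}.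
  by apply: differentiable_continuous; apply/derivable1_diffP.
split; first by move=> x _.
- by apply: cvg_at_right_filter; exact: cF.
- by apply: cvg_at_left_filter; exact: cF.
Qed.

(** The factor [b] prepares the induction on the dimension: it will be the indicator that all other
    components of the frequency vanish. *)
Lemma integral_onePcos (b phi : R) (n : int) :
  (\int[mu]_(t in `[0%R, 1%R]) (1 + b * cos (2 * pi * n%:~R * t + phi))%:E =
   (1 + b * (n == 0)%:R * cos phi)%:E)%E.
Proof.
have [->|n0] := eqVneq n 0.
  rewrite (eq_integral (fun=> (1 + b * cos phi)%:E)); last first.
    by move=> t _; rewrite mulr0 mul0r add0r.
  rewrite integral_cst//= lebesgue_measure_itv/= lte_fin ltr01 sube0 mule1.
  by rewrite mulr1.
pose a : R := 2 * pi * n%:~R.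
have a0 : a != 0 by rewrite !mulf_neq0 ?intr_eq0 ?pnatr_eq0// gt_eqF// pi_gt0.
pose F t := t + (b / a) * sin (a * t + phi).
have dF t : is_derive t (1 : R) F (1 + b * cos (a * t + phi)).
  have := is_deriveD (is_derive_id t (1 : R)) (is_deriveZ (b / a) (is_derive_sin_lin a phi t)).
  by rewrite /GRing.scale /= mulrA divfK.
rewrite (@continuous_FTC2 _ _ F)//.
- have sinE : sin (a * 1 + phi) = sin phi by rewrite mulr1 addrC sinD2piz.
  rewrite /F sinE mulr0 !add0r -EFinB mulr0 mul0r; congr EFin; ring.
- apply: continuous_subspaceT => t; apply: cvgD; first exact: cvg_cst.
  by apply: cvgMr; exact: continuous_cos_lin.
- by apply: derivable_oo_LRcontinuous_derivable => x; apply: ex_derive.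
- by move=> x _; rewrite derive1E; apply: derive_val.
Qed.

End TrigonometricIntegrals.

Section CubeIntegrals.
Context {R : realType}.
Local Notation mu := (@lebesgue_measure R).

Lemma measurable_phase (d : nat) (k : d.-tuple int) :
  measurable_fun [set: d.-tuple R] (phase k).
Proof.
apply: measurable_funM => //; apply: measurable_sum => j.
by apply: measurable_funM => //; exact: measurable_tnth.
Qed.

Lemma measurable_unit_cube (d : nat) : measurable (@unit_cube R d).
Proof.
have -> : unit_cube d = \bigcap_(j in [set: 'I_d])
    ((fun x : d.-tuple R => tnth x j) @^-1` `[0, 1]).
  apply/seteqP; split=> x /= H j; last by have := H j I; rewrite /= in_itv.
  by move=> _; rewrite /= in_itv; exact: H.
apply: fin_bigcap_measurable => // j _.
rewrite -[X in measurable X]setTI.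
by apply: measurable_tnth.
Qed.

Lemma unit_cube_cons (d : nat) (t : R) (y : d.-tuple R) :
  unit_cube d.+1 (tuple_cons (t, y)) <-> 0 <= t <= 1 /\ unit_cube d y.
Proof.
split=> [H|[Ht Hy] j].
  split=> [|j]; first exact: (H ord0).
  by have := H (lift ord0 j); rewrite /tuple_cons tnthS.
by case: (unliftP ord0 j) => [i|] ->; rewrite /tuple_cons ?tnthS ?tnth0.
Qed.

Lemma phase_cons (d : nat) (k : d.+1.-tuple int) (t : R) (y : d.-tuple R) :
  phase k (tuple_cons (t, y)) =
  2 * pi * (thead k)%:~R * t + phase [tuple of behead k] y.
Proof.
rewrite /phase big_ord_recl mulrDr mulrA /tuple_cons tnth0; congr (_ + _ * _).
apply: eq_bigr => j _; rewrite tnthS; congr (_%:~R * _).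
by rewrite [in LHS](tuple_eta k) tnthS.
Qed.

Lemma tuple_eq0_cons (d : nat) (k : d.+1.-tuple int) :
  [forall j, tnth k j == 0] =
  (thead k == 0) && [forall j, tnth [tuple of behead k] j == 0].
Proof.
apply/forallP/andP => [H|[H0 /forallP H] j].
  split; first exact: H.
  apply/forallP => j; have := H (lift ord0 j).
  by rewrite [in X in X -> _](tuple_eta k) tnthS.
case: (unliftP ord0 j) => [i|] ->; last exact: H0.
by rewrite (tuple_eta k) tnthS.
Qed.

(* Adding [1] to the cosine makes the integrand nonnegative, so that Tonelli's
   theorem applies without integrability conditions. *)
Lemma cube_integral_onePcos (d : nat) (k : d.-tuple int) (phi : R) :
  (\int[cube_measure d]_(x in unit_cube d) (1 + cos (phase k x + phi))%:E =
   (1 + [forall j, tnth k j == 0]%:R * cos phi)%:E)%E.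
Proof.
have measP d' (k' : d'.-tuple int) phi' :
    measurable_fun [set: d'.-tuple R] (fun x => (1 + cos (phase k' x + phi'))%:E).
  apply/measurable_EFinP; apply: measurable_funD => //.
  apply: (measurableT_comp (continuous_measurable_fun (@continuous_cos R))).
  by apply: measurable_funD => //; exact: measurable_phase.
have onePcos_ge0 (x : R) : 0 <= 1 + cos x by rewrite -lerBlDl sub0r cos_geN1.
elim: d k phi => [|d IH] k phi.
  rewrite (@integral_dirac _ _ _ _ _ (measurable_unit_cube (d:=0))); last first.
    by apply: measurable_funTS; exact: measP.
  have -> : [forall j, tnth k j == 0] by apply/forallP => -[].
  rewrite diracE mem_set; last by case.
  by rewrite mul1e /phase big_ord0 mulr0 add0r mul1r.
rewrite integral_mkcond.
set g := _ \_ _.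
have mg : measurable_fun setT g.
  apply: (measurable_restrictT
    (fun x : d.+1.-tuple R => (1 + cos (phase k x + phi))%:E)
    (@measurable_unit_cube d.+1)).1.
  by apply: measurable_funTS; exact: measP.
have g0 x : (0 <= g x)%E.
  by apply: erestrict_ge0 => y _; rewrite lee_fin.
have mgc := measurableT_comp mg (@measurable_tuple_cons R d).
have gc0 x : (0 <= (g \o @tuple_cons R d) x)%E by exact: g0.
rewrite ge0_integral_distribution// fubini_tonelli1//.
pose b : R := [forall j, tnth [tuple of behead k] j == 0]%:R.
pose h (t : R) := (1 + b * cos (2 * pi * (thead k)%:~R * t + phi))%:E.
have h0 t : (0 <= h t)%E.
  rewrite lee_fin /b; case: [forall _, _]; last by rewrite mul0r addr0.
  by rewrite mul1r.
(* For [t] in the unit interval the inner integral is the induction hypothesis with [phi] shifted by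
   the contribution of the first coordinate; for any other [t] the slice of the cube is empty. *)
transitivity (\int[uniform_prob (@ltr01 R)]_t (h \_ `[0%R, 1%R]) t)%E.
  apply: eq_integral => t _; rewrite /fubini_F patchE.
  case: ifPn => [|/negP]; rewrite inE /= in_itv /= => t01.
    rewrite /h -(IH _ (2 * pi * (thead k)%:~R * t + phi)).
    rewrite [RHS]integral_mkcond; apply: eq_integral => y _.
    rewrite /g /= !patchE.
    have -> : (tuple_cons (t, y) \in unit_cube d.+1) = (y \in unit_cube d).
      apply/idP/idP; rewrite !inE; first by move=> /unit_cube_cons[].
      by move=> Uy; apply/unit_cube_cons.
    by case: ifP => // _; rewrite phase_cons addrCA addrA.
  apply: integral0_eq => y _; rewrite /g /= patchE memNset//.
  by move=> /unit_cube_cons[].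
rewrite integral_uniform.
- rewrite subr0 invr1 mul1e.
  transitivity (\int[mu]_(t in `[0%R, 1%R]) h t)%E.
    by apply: eq_integral => t t01; rewrite patchE t01.
  rewrite /h integral_onePcos tuple_eq0_cons /b.
  by case: (thead k == 0); rewrite /= ?mulr1 ?mulr0.
- apply: (measurable_restrictT h (measurable_itv _)).1.
  apply: measurable_funTS; apply/measurable_EFinP.
  apply: continuous_measurable_fun => t; apply: cvgD; first exact: cvg_cst.
  by apply: cvgMr; exact: continuous_cos_lin.
- by move=> t; apply: erestrict_ge0 => y _.
Qed.

(** At frequency and phase zero the integrand [1 + cos] is the constant 2, so the integral just
    computed yields the mass. *)
Lemma cube_measure_unit (d : nat) : cube_measure d (@unit_cube R d) = 1%E.
Proof.
have mU := @measurable_unit_cube d.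
have := cube_integral_onePcos [tuple (0 : int) | j < d] 0.
rewrite (eq_integral (fun=> 2%:E)); last first.
  move=> x _; rewrite addr0 /phase big1 ?mulr0 ?cos0 // => j _.
  by rewrite tnth_mktuple mul0r.
have -> : [forall j, tnth [tuple (0 : int) | _ < d] j == 0].
  by apply/forallP => j; rewrite tnth_mktuple.
rewrite integral_cst// cos0 mulr1 => H.
have {}H : (2%:E * cube_measure d (@unit_cube R d) = 2%:E)%E by exact: H.
have /fineK mE : cube_measure d (@unit_cube R d) \is a fin_num.
  exact: fin_num_measure.
by move: H; rewrite -mE -EFinM => -[H]; congr EFin; lra.
Qed.

Lemma cube_integrable (d : nat) (f : d.-tuple R -> R) (M : R) :
  measurable_fun (unit_cube d) f -> (forall x, unit_cube d x -> `|f x| <= M) ->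
  (cube_measure d).-integrable (unit_cube d) (EFin \o f).
Proof.
move=> mf fM; apply: measurable_bounded_integrable => //.
- exact: measurable_unit_cube.
- exact: (le_lt_trans (probability_le1 _ (@measurable_unit_cube d)) (ltry 1)).
- exists M; split; first exact: num_real.
  by move=> y My x Ux; apply: (le_trans (fM x Ux)); exact: ltW.
Qed.

Lemma measurable_cos_phase (d : nat) (k : d.-tuple int) (phi : R) D :
  measurable_fun D (fun x : d.-tuple R => cos (phase k x + phi)).
Proof.
apply: measurable_funTS.
apply: (measurableT_comp (continuous_measurable_fun (@continuous_cos R))).
by apply: measurable_funD => //; exact: measurable_phase.
Qed.

Lemma integrable_cos_phase (d : nat) (k : d.-tuple int) (phi : R) :
  (cube_measure d).-integrable (unit_cube d)
    (fun x => (cos (phase k x + phi))%:E).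
Proof.
apply: (@cube_integrable _ (fun x => cos (phase k x + phi)) 1).
  exact: measurable_cos_phase.
by move=> x _; exact: cos_max.
Qed.

Lemma cube_integral_cos (d : nat) (k : d.-tuple int) (phi : R) :
  \int[cube_measure d]_(x in unit_cube d) cos (phase k x + phi) =
  [forall j, tnth k j == 0]%:R * cos phi.
Proof.
have mU := @measurable_unit_cube d.
have ic : (cube_measure d).-integrable (unit_cube d) (EFin \o cst (1 : R)).
  by apply: (@cube_integrable _ _ 1) => // x _; rewrite normr1.
have : \int[cube_measure d]_(x in unit_cube d) (1 + cos (phase k x + phi)) =
    1 + [forall j, tnth k j == 0]%:R * cos phi.
  by rewrite /Rintegral cube_integral_onePcos.
rewrite RintegralD//; last exact: integrable_cos_phase.
rewrite Rintegral_cst//; set m := fine _.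
have -> : m = 1 by exact: (congr1 fine (cube_measure_unit d)).
by rewrite mulr1 => /addrI.
Qed.

End CubeIntegrals.

(** * Fejer means of continuous periodic functions *)

Section ContinuousTuple.
Context {R : realType} {d : nat}.
Variable g : d.-tuple R -> R.
Hypothesis cg : continuous (fun v : 'rV[R]_d => g [tuple v ord0 j | j < d]).

Let rowK (x : d.-tuple R) : [tuple (\row_j tnth x j) ord0 j | j < d] = x.
Proof. by apply: eq_from_tnth => j; rewrite tnth_mktuple mxE. Qed.

Lemma continuous_tuple_delta (x : d.-tuple R) (e : R) : 0 < e ->
  exists2 r : R, 0 < r & forall y : d.-tuple R,
    (forall j, `|tnth x j - tnth y j| < r) -> `|g x - g y| < e.
Proof.
move=> e0; have /(_ (\row_j tnth x j))/cvgrPdist_lt/(_ e e0) := cg.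
move=> /nbhs_ballP[r /= r0 H]; exists r => // y xy.
have := H (\row_j tnth y j); rewrite /= !rowK; apply.
by split=> // i j; rewrite /ball /= !mxE; exact: xy.
Qed.

Lemma continuous_tuple_bounded :
  exists M : R, forall x, unit_cube d x -> `|g x| <= M.
Proof.
pose A := [set v : 'rV[R]_d | forall j, `[0, 1]%classic (v ord0 j)].
have cA : compact A.
  by apply: (@rV_compact R d (fun=> `[0, 1]%classic)) => j; exact: segment_compact.
have /compact_bounded[M [_ HM]] :=
  continuous_compact (continuous_subspaceT cg) cA.
exists (M + 1) => x Ux.
apply: (HM (M + 1)); first by rewrite ltrDl.
exists (\row_j tnth x j); last by rewrite rowK.
by move=> j; rewrite mxE /= in_itv; exact: Ux.
Qed.

(* [g] is the pointwise limit of [g] composed with the rounding of the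
   coordinates to multiples of [1 / n.+1], which takes countably many values. *)
Lemma measurable_continuous_tuple (D : set (d.-tuple R)) : measurable_fun D g.
Proof.
apply: measurable_funTS.
pose q (n : nat) (x : d.-tuple R) : d.-tuple int :=
  [tuple Num.floor (n.+1%:R * tnth x j) | j < d].
pose p (n : nat) (z : d.-tuple int) : d.-tuple R :=
  [tuple (tnth z j)%:~R / n.+1%:R | j < d].
apply: (measurable_fun_cvg (h := fun n => g \o p n \o q n)) => [n|x _].
  move=> _ Y mY; rewrite setTI.
  have -> : (g \o p n \o q n) @^-1` Y =
      \bigcup_(z in [set z | Y (g (p n z))]) (q n @^-1` [set z]).
    apply/seteqP; split => [x Yx|x [z Yz /= qz]]; first by exists (q n x).
    by rewrite /preimage /= qz.
  rewrite bigcup_mkcond.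
  apply: countable_bigcupT_measurable => [|z]; first exact: countableP.
  case: ifP => // _.
  have -> : q n @^-1` [set z] = \bigcap_(j in [set: 'I_d])
      (fun x : d.-tuple R => tnth x j) @^-1`
        (`[(tnth z j)%:~R / n.+1%:R, ((tnth z j) + 1)%:~R / n.+1%:R[).
    apply/seteqP; split=> x /=.
      move=> <- j _; rewrite /= in_itv /= tnth_mktuple.
      by rewrite ler_pdivrMr// ltr_pdivlMr// mulrC floor_itv.
    move=> H; apply: eq_from_tnth => j; rewrite tnth_mktuple.
    have := H j I; rewrite /= in_itv /= ler_pdivrMr// ltr_pdivlMr// mulrC => ?.
    by apply/eqP; rewrite floor_eq.
  apply: fin_bigcap_measurable => // j _.
  rewrite -[X in measurable X]setTI; apply: measurable_tnth => //.
apply/cvgrPdist_lt => e e0; have [r r0 H] := continuous_tuple_delta x e0.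
near=> n; apply: H => j.
have n0 : 0 < n.+1%:R :> R by [].
rewrite /= !tnth_mktuple.
have /andP[H1 H2] := floor_itv (n.+1%:R * tnth x j).
set m := Num.floor _ in H1 H2 *.
have -> : tnth x j - m%:~R / n.+1%:R = (n.+1%:R * tnth x j - m%:~R) / n.+1%:R.
  by field; rewrite addrC natr1 pnatr_eq0.
rewrite normrM normfV !ger0_norm ?subr_ge0// ltr_pdivrMr//.
rewrite intrD in H2.
apply: (@lt_le_trans _ _ 1); first by lra.
rewrite -ler_pdivrMr// div1r ltW//.
by near: n; exact: (near_infty_natSinv_lt (PosNum r0)).
Unshelve. all: end_near.
Qed.

End ContinuousTuple.

(** * Periodicity and a modulus of continuity on the torus *)

Section Periodic.
Context {R : realType} {d : nat}.
Variable g : d.-tuple R -> R.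
Hypothesis pg : forall (x : d.-tuple R) (j : 'I_d),
  g [tuple tnth x i + (i == j)%:R | i < d] = g x.

(** The integer vectors that are periods of [g] form a group containing the unit vectors. *)
Lemma periodic_shift (m : 'I_d -> int) (x : d.-tuple R) :
  g [tuple tnth x i + (m i)%:~R | i < d] = g x.
Proof.
pose P (m : {ffun 'I_d -> int}) :=
  forall x : d.-tuple R, g [tuple tnth x i + (m i)%:~R | i < d] = g x.
have P0 : P 0.
  move=> y; congr g; apply: eq_from_tnth => j.
  by rewrite tnth_mktuple ffunE addr0.
have PD m1 m2 : P m1 -> P m2 -> P (m1 + m2).
  move=> H1 H2 y; rewrite -[RHS]H1 -[RHS]H2; congr g; apply: eq_from_tnth => j.
  by rewrite !tnth_mktuple ffunE intrD addrA.
have PN m1 : P m1 -> P (- m1).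
  move=> H1 y; rewrite -[LHS]H1; congr g; apply: eq_from_tnth => j.
  by rewrite !tnth_mktuple ffunE intrN subrK.
have PMz m1 z : P m1 -> P (m1 *~ z).
  move=> H1; have Pn n : P (m1 *+ n).
    by elim: n => [|n IH]; [rewrite mulr0n|rewrite mulrS; exact: PD].
  by case: z => n; [exact: Pn|exact/PN/Pn].
pose e (j : 'I_d) : {ffun 'I_d -> int} := [ffun i => (i == j)%:R].
have Pe j : P (e j).
  move=> y; rewrite -[RHS](pg _ j); congr g; apply: eq_from_tnth => i.
  by rewrite !tnth_mktuple ffunE; case: (i == j).
have : P (\sum_j (e j) *~ (m j)) by apply: big_ind => // j _; exact: PMz.
move=> /(_ x) <-; congr g; apply: eq_from_tnth => i.
have eE j z : (e j *~ z) i = z * (i == j)%:R.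
  have nE n : (e j *+ n) i = Posz n * (i == j)%:R.
    by rewrite ffunMnE ffunE -[Posz n]natz mulr_natl.
  case: z => n; first by rewrite -pmulrn nE.
  by rewrite NegzE mulrNz -pmulrn ffunE nE mulNr.
rewrite !tnth_mktuple sum_ffunE; congr (_ + _%:~R).
rewrite (bigD1 i)//= big1 => [|j ji]; first by rewrite addr0 eE eqxx mulr1.
by rewrite eE eq_sym (negbTE ji) mulr0.
Qed.

End Periodic.

Section Korovkin.
Context {R : realType} {d : nat}.
Variable g : d.-tuple R -> R.
Hypothesis cg : continuous (fun v : 'rV[R]_d => g [tuple v ord0 j | j < d]).
Hypothesis pg : forall (x : d.-tuple R) (j : 'I_d),
  g [tuple tnth x i + (i == j)%:R | i < d] = g x.

(* The right-hand side integrates explicitly against the Fejer kernel, whatever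
   the shape of that kernel away from the diagonal. *)
Lemma periodic_modulus (x : d.-tuple R) (e : R) : unit_cube d x -> 0 < e ->
  exists2 C : R, 0 <= C & forall y, unit_cube d y ->
    `|g y - g x| <= e + C * \sum_(j < d) (1 - cos (2 * pi * (tnth x j - tnth y j))).
Proof.
move=> Ux e0.
have [r r0 H] := continuous_tuple_delta cg x e0.
have [M HM] := continuous_tuple_bounded cg.
have M0 : 0 <= M by apply: (le_trans _ (HM x Ux)).
(* [eta] may vanish for large [r], and then [2 * M / eta] is 0 by the convention on division by
   zero. The bound uses it only when some [t j] below has modulus at least [r]; this forces
   [r <= 1 / 2], hence [eta > 0]. *)
pose eta := 1 - cos (2 * pi * r).
have eta0 : 0 <= eta by rewrite subr_ge0 cos_le1.
have C0 : 0 <= 2 * M / eta by rewrite divr_ge0// mulr_ge0.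
exists (2 * M / eta) => // y Uy.
(* [m j] is a nearest integer to the coordinate difference, so [t j] is the difference on the
   torus. *)
pose m j : int := Num.floor (tnth x j - tnth y j + 1 / 2).
pose t j : R := tnth x j - (tnth y j + (m j)%:~R).
have tE j : t j = (tnth x j - tnth y j) - (m j)%:~R by rewrite /t; ring.
have t2 j : `|t j| <= 1 / 2.
  have /andP[H1 H2] := floor_itv (tnth x j - tnth y j + 1 / 2).
  rewrite -/(m j) intrD in H1 H2.
  by rewrite tE ler_norml; lra.
have cosE j : cos (2 * pi * (tnth x j - tnth y j)) = cos (2 * pi * `|t j|).
  have -> : cos (2 * pi * `|t j|) = cos (2 * pi * t j).
    by rewrite -[RHS]cos_norm normrM ger0_norm// mulr_ge0// pi_ge0.
  by rewrite -[RHS](cosD2piz _ (m j)) tE; congr cos; ring.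
have S0 : 0 <= \sum_(j < d) (1 - cos (2 * pi * (tnth x j - tnth y j))).
  by apply: sumr_ge0 => j _; rewrite subr_ge0 cos_le1.
have [near_x|] := boolP [forall j, `|t j| < r].
  rewrite -(periodic_shift pg m y) distrC ltW//.
  apply: (@lt_le_trans _ _ e); last by rewrite lerDl mulr_ge0.
  by apply: H => j; rewrite tnth_mktuple; exact: (forallP near_x).
rewrite negb_forall => /existsP[j]; rewrite -leNgt => rt.
have eta_lt : 0 < eta.
  rewrite subr_gt0 -[ltRHS]cos0 ltr_cos.
  - by rewrite !mulr_gt0 ?pi_gt0.
  - by rewrite in_itv /= lexx pi_ge0.
  - rewrite in_itv /=; have := t2 j; have := @pi_gt0 R; nra.
have etaj : eta <= 1 - cos (2 * pi * (tnth x j - tnth y j)).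
  rewrite cosE lerD2l lerN2 /eta.
  have tj := t2 j; have p0 := @pi_gt0 R.
  move: rt; rewrite le_eqVlt => /predU1P[<-//|rt].
  rewrite ltW// ltr_cos; first by rewrite ltr_pM2l// mulr_gt0.
  - by rewrite in_itv /=; nra.
  - by rewrite in_itv /=; nra.
apply: (@le_trans _ _ (2 * M)).
  rewrite mulr_natl mulr2n; apply: (le_trans (ler_normB _ _)).
  by apply: lerD; exact: HM.
apply: (@le_trans _ _ (2 * M / eta * eta)); first by rewrite divfK// gt_eqF.
apply: (@le_trans _ _ (2 * M / eta * \sum_(j < d) (1 - cos (2 * pi * (tnth x j - tnth y j)))));
  last by rewrite lerDr ltW.
apply: ler_wpM2l => //; apply: (le_trans etaj).
rewrite (bigD1 j)//= lerDl; apply: sumr_ge0 => i _.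
by rewrite subr_ge0 cos_le1.
Qed.

End Korovkin.

(** * The Fejer kernel and its moments *)

Section FejerKernel.
Context {R : realType}.

Lemma cube_Rintegral_sum (d : nat) (I : Type) (s : seq I) (h : I -> d.-tuple R -> R) :
  (forall i, (cube_measure d).-integrable (unit_cube d) (EFin \o h i)) ->
  \int[cube_measure d]_(x in unit_cube d) (\sum_(i <- s) h i x) =
  \sum_(i <- s) \int[cube_measure d]_(x in unit_cube d) h i x.
Proof.
move=> ih; have mU := @measurable_unit_cube R d.
have is' (t : seq I) : (cube_measure d).-integrable (unit_cube d)
    (EFin \o (fun x => \sum_(i <- t) h i x)).
  have := integrable_sum mU t (P := xpredT) (fun i _ => ih i).
  by apply: eq_integrable => // x _; rewrite /= sumEFin.
elim: s => [|i s IH].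
  under eq_Rintegral do rewrite big_nil.
  by rewrite big_nil Rintegral_cst// mul0r.
rewrite big_cons -IH -RintegralD//.
by apply: eq_Rintegral => x _; rewrite big_cons.
Qed.

Lemma integrable_cos_phaseB (d : nat) (k : d.-tuple int) (x : d.-tuple R) :
  (cube_measure d).-integrable (unit_cube d)
    (fun y => (cos (phase k x - phase k y))%:E).
Proof.
have := integrable_cos_phase k (- phase k x).
apply: eq_integrable; first exact: measurable_unit_cube.
by move=> y _; rewrite -cosN opprB.
Qed.

Lemma cube_integral_cosB (d : nat) (k : d.-tuple int) (x : d.-tuple R) :
  \int[cube_measure d]_(y in unit_cube d) cos (phase k x - phase k y) =
  [forall j, tnth k j == 0]%:R.
Proof.
transitivity (\int[cube_measure d]_(y in unit_cube d) cos (phase k y + - phase k x)).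
  by apply: eq_Rintegral => y _; rewrite -cosN opprB.
rewrite cube_integral_cos; case: forallP => [k0|_]; last by rewrite mul0r.
rewrite /phase big1 ?mulr0 ?oppr0 ?cos0 ?mulr1// => j _.
by rewrite (eqP (k0 j)) mul0r.
Qed.

Variables (d n : nat).
Local Notation FF := {ffun 'I_d -> 'I_n}.

Definition freqdiff (p : FF * FF) : d.-tuple int :=
  [tuple (p.1 j)%:Z - (p.2 j)%:Z | j < d].

(** The product of the one-dimensional Fejer kernels, expanded into a sum over pairs of frequency
    vectors with components from 0 to n - 1. In this form positivity and integrals become statements
    about pairs. *)
Definition fejer (x y : d.-tuple R) : R :=
  (n%:R ^+ d)^-1 * \sum_p cos (phase (freqdiff p) x - phase (freqdiff p) y).

(** The double sum is the squared modulus of the sum of the exponentials with angles [th a]. *)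
Lemma fejer_ge0 x y : 0 <= fejer x y.
Proof.
rewrite /fejer mulr_ge0// ?invr_ge0 ?exprn_ge0//.
pose th (a : FF) := phase [tuple (a j)%:Z | j < d] x - phase [tuple (a j)%:Z | j < d] y.
have -> : \sum_p cos (phase (freqdiff p) x - phase (freqdiff p) y) =
    \sum_(a : FF) \sum_(b : FF) cos (th a - th b).
  rewrite pair_big; apply: eq_bigr => -[a b] _ /=; congr cos.
  rewrite /th /phase -!mulrBr; congr (_ * _); rewrite -!sumrB.
  by apply: eq_bigr => j _; rewrite !tnth_mktuple intrB; ring.
have -> : \sum_(a : FF) \sum_(b : FF) cos (th a - th b) =
    (\sum_a cos (th a)) ^+ 2 + (\sum_a sin (th a)) ^+ 2.
  rewrite !expr2 !mulr_suml -big_split; apply: eq_bigr => a _.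
  rewrite !mulr_sumr -big_split; apply: eq_bigr => b _.
  by rewrite cosB.
by rewrite addr_ge0 ?sqr_ge0.
Qed.

(** By orthogonality, integrals against the kernel count pairs of frequency vectors with a
    prescribed difference [s]. The count factors over the coordinates, and only the shifts 0 and 1
    are needed. *)
Lemma sum_shift_eq (s : 'I_d -> nat) :
  \sum_(p : FF * FF) [forall j, p.1 j + s j == p.2 j]%N%:R =
  \prod_j (\sum_(a < n) \sum_(b < n) (a + s j == b)%N%:R) :> R.
Proof.
rewrite bigA_distr_bigA -(pair_big xpredT xpredT
  (fun a b : FF => [forall j, a j + s j == b j]%N%:R))/=.
apply: eq_bigr => a _; rewrite bigA_distr_bigA; apply: eq_bigr => b _.
case: forallP => [H|/forallP].
  by rewrite big1// => j _; rewrite H.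
rewrite negb_forall => /existsP[j /negbTE H].
by rewrite (bigD1 j)//= H mul0r.
Qed.

Lemma sum_ord_shift0 : \sum_(a < n) \sum_(b < n) (a + 0 == b)%N%:R = n%:R :> R.
Proof.
rewrite -[n in RHS](card_ord n) -sum1_card natr_sum; apply: eq_bigr => a _.
rewrite (bigD1 a)//= addn0 eqxx big1 ?addr0// => b ba.
by rewrite eq_sym; move: ba; rewrite -val_eqE => /negbTE ->.
Qed.

Lemma sum_ord_shift1 : \sum_(a < n) \sum_(b < n) (a + 1 == b)%N%:R = n.-1%:R :> R.
Proof.
case: n => [|m]; first by rewrite big_ord0.
rewrite big_ord_recr /= [X in _ + X]big1 => [|b _].
  rewrite addr0 -[m in RHS](card_ord m) -sum1_card natr_sum; apply: eq_bigr => a _.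
  rewrite (bigD1 (lift ord0 a))//= /bump /= addnC eqxx big1 ?addr0// => b ba.
  by rewrite eq_sym; move: ba; rewrite -val_eqE /= /bump /= => /negbTE ->.
by rewrite addn1 gtn_eqF.
Qed.

Hypothesis n0 : (0 < n)%N.

Let n0R : n%:R != 0 :> R. Proof. by rewrite pnatr_eq0 -lt0n. Qed.

Let integrable_sum_cos (k : FF * FF -> d.-tuple int) (x : d.-tuple R) :
  (cube_measure d).-integrable (unit_cube d)
    (EFin \o (fun y => \sum_p cos (phase (k p) x - phase (k p) y))).
Proof.
have mU := @measurable_unit_cube R d.
have := integrable_sum mU (index_enum (FF * FF)%type) (P := xpredT)
  (fun p _ => integrable_cos_phaseB (k p) x).
by apply: eq_integrable => // y _; rewrite /= sumEFin.
Qed.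

Lemma integrable_fejer x :
  (cube_measure d).-integrable (unit_cube d) (EFin \o fejer x).
Proof.
have mU := @measurable_unit_cube R d.
have := integrableZl mU (n%:R ^+ d)^-1 (integrable_sum_cos freqdiff x).
by apply: eq_integrable.
Qed.

Let Rintegral_sum_cos (k : FF * FF -> d.-tuple int) (x : d.-tuple R) :
  \int[cube_measure d]_(y in unit_cube d)
    (\sum_p cos (phase (k p) x - phase (k p) y)) =
  \sum_p [forall j, tnth (k p) j == 0]%:R.
Proof.
rewrite cube_Rintegral_sum; last by move=> p; exact: integrable_cos_phaseB.
by apply: eq_bigr => p _; exact: cube_integral_cosB.
Qed.

Lemma fejer_integral x :
  \int[cube_measure d]_(y in unit_cube d) fejer x y = 1.
Proof.
have mU := @measurable_unit_cube R d.
rewrite (RintegralZl _ mU (integrable_sum_cos freqdiff x)).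
rewrite (Rintegral_sum_cos freqdiff).
rewrite (eq_bigr (fun p : FF * FF => [forall j, p.1 j + 0 == p.2 j]%N%:R)); last first.
  move=> p _; congr (_%:R); congr nat_of_bool; apply: eq_forallb => j.
  by rewrite tnth_mktuple subr_eq0 addn0.
rewrite (sum_shift_eq (fun=> 0%N)) prodr_const card_ord sum_ord_shift0.
by rewrite mulVf// expf_neq0.
Qed.

Lemma phaseD (k l : d.-tuple int) (x : d.-tuple R) :
  phase [tuple tnth k j + tnth l j | j < d] x = phase k x + phase l x.
Proof.
rewrite /phase -mulrDr -big_split /=; congr (_ * _).
by apply: eq_bigr => j _; rewrite tnth_mktuple intrD mulrDl.
Qed.

Lemma phaseB (k l : d.-tuple int) (x : d.-tuple R) :
  phase [tuple tnth k j - tnth l j | j < d] x = phase k x - phase l x.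
Proof.
rewrite /phase -mulrBr -sumrB; congr (_ * _).
by apply: eq_bigr => j _; rewrite tnth_mktuple intrB mulrBl.
Qed.

Lemma phase_unit (j : 'I_d) (x : d.-tuple R) :
  phase [tuple (i == j)%:Z | i < d] x = 2 * pi * tnth x j.
Proof.
rewrite /phase (bigD1 j)//= tnth_mktuple eqxx mul1r big1 ?addr0// => i ij.
by rewrite tnth_mktuple (negbTE ij) mul0r.
Qed.

(** Multiplication by the cosine shifts the frequencies by [e] or by its negative. Each shifted sum
    counts (n - 1) n^(d-1) pairs, so the value is 1 - (n - 1)/n. *)
Lemma fejer_integral_onemcos x (j : 'I_d) :
  \int[cube_measure d]_(y in unit_cube d)
    (fejer x y * (1 - cos (2 * pi * (tnth x j - tnth y j)))) = n%:R^-1.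
Proof.
have mU := @measurable_unit_cube R d.
pose e : d.-tuple int := [tuple (i == j)%:Z | i < d].
pose kp (p : FF * FF) : d.-tuple int := [tuple tnth (freqdiff p) i + tnth e i | i < d].
pose km (p : FF * FF) : d.-tuple int := [tuple tnth (freqdiff p) i - tnth e i | i < d].
pose c : R := (n%:R ^+ d)^-1 / 2.
have E y : fejer x y * (1 - cos (2 * pi * (tnth x j - tnth y j))) =
    fejer x y - c * (\sum_p cos (phase (kp p) x - phase (kp p) y)) -
    c * (\sum_p cos (phase (km p) x - phase (km p) y)).
  have -> : 2 * pi * (tnth x j - tnth y j) = phase e x - phase e y.
    by rewrite !phase_unit mulrBr.
  rewrite mulrBr mulr1 -addrA -opprD; congr (_ - _).
  rewrite /c /fejer -!mulrA -mulrDr; congr (_ * _).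
  rewrite -mulrDr -big_split /= mulr_suml mulr_sumr; apply: eq_bigr => p _.
  rewrite !phaseD !phaseB.
  set a := phase _ x; set b := phase _ x; set a' := phase _ y; set b' := phase _ y.
  rewrite (_ : a + b - (a' + b') = (a - a') + (b - b')); last by ring.
  rewrite (_ : a - b - (a' - b') = (a - a') - (b - b')); last by ring.
  move: (a - a') (b - b') => u v.
  by rewrite cosD cosB; field.
under eq_Rintegral do rewrite E.
have ic (k : FF * FF -> d.-tuple int) : (cube_measure d).-integrable (unit_cube d)
    (EFin \o (fun y => c * (\sum_p cos (phase (k p) x - phase (k p) y)))).
  have := integrableZl mU c (integrable_sum_cos k x).
  by apply: eq_integrable.
rewrite RintegralB//; last first.
  have := integrableB mU (integrable_fejer x) (ic kp).
  by apply: eq_integrable.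
rewrite RintegralB//; last exact: integrable_fejer.
rewrite (RintegralZl _ mU (integrable_sum_cos kp x)) (RintegralZl _ mU (integrable_sum_cos km x)).
rewrite fejer_integral (Rintegral_sum_cos kp) (Rintegral_sum_cos km).
have S1 : \sum_(p : FF * FF) [forall i, p.1 i + (i == j) == p.2 i]%N%:R =
    n.-1%:R * n%:R ^+ d.-1 :> R.
  rewrite (sum_shift_eq (fun i => (i == j) : nat)) (bigD1 j)//= eqxx sum_ord_shift1.
  congr (_ * _); rewrite (eq_bigr (fun=> n%:R)).
    by rewrite prodr_const cardC1 card_ord.
  by move=> i /negbTE ->; rewrite sum_ord_shift0.
have Sp : \sum_p [forall i, tnth (kp p) i == 0]%:R = n.-1%:R * n%:R ^+ d.-1 :> R.
  rewrite -S1; apply: eq_bigr => p _; congr (_%:R); congr nat_of_bool.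
  apply: eq_forallb => i; rewrite !tnth_mktuple addrAC subr_eq0.
  by rewrite -PoszD.
(* Exchanging the members of a pair negates the difference and reduces this shift to the previous
   one. *)
have Sm : \sum_p [forall i, tnth (km p) i == 0]%:R = n.-1%:R * n%:R ^+ d.-1 :> R.
  rewrite -S1 (reindex_inj (h := fun p : FF * FF => (p.2, p.1))) /=; last first.
    by move=> [a b] [a' b'] [-> ->].
  apply: eq_bigr => p _; congr (_%:R); congr nat_of_bool.
  apply: eq_forallb => i; rewrite !tnth_mktuple -addrA -opprD subr_eq0.
  by rewrite -PoszD eq_sym.
rewrite Sp Sm /c.
have d0 : (0 < d)%N by exact: (leq_ltn_trans (leq0n j) (ltn_ord j)).
rewrite -[in (n%:R ^+ d)^-1](prednK d0) exprS -(subn1 n) natrB//.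
have nd : n%:R ^+ d.-1 != 0 :> R by rewrite expf_neq0.
by field; rewrite nd n0R.
Qed.

End FejerKernel.

(** * Convergence of the Fejer means and their Fourier form *)

Section FejerMeans.
Context {R : realType} {d : nat}.

Section Real.
Variable g : d.-tuple R -> R.
Hypothesis cg : continuous (fun v : 'rV[R]_d => g [tuple v ord0 j | j < d]).
Hypothesis pg : forall (x : d.-tuple R) (j : 'I_d),
  g [tuple tnth x i + (i == j)%:R | i < d] = g x.

Lemma integrable_continuousM (h : d.-tuple R -> R) :
  (cube_measure d).-integrable (unit_cube d) (EFin \o h) ->
  (cube_measure d).-integrable (unit_cube d) (EFin \o (fun y => g y * h y)).
Proof.
move=> ih; have mU := @measurable_unit_cube R d.
have [M HM] := continuous_tuple_bounded cg.
have := integrableMr mU (measurable_continuous_tuple cg (D := unit_cube d)) _ ih.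
move=> H; apply: eq_integrable (H _) => //.
exists M; split; first exact: num_real.
by move=> y My x Ux; apply: (le_trans (HM x Ux)); exact: ltW.
Qed.

(** The kernel is nonnegative with integral 1, so integrating [periodic_modulus] against it bounds
    the difference by e/2 + C d / n. *)
Lemma fejer_mean_near (x : d.-tuple R) (e : R) : unit_cube d x -> 0 < e ->
  exists m, forall n, (m < n)%N ->
    `|\int[cube_measure d]_(y in unit_cube d) (g y * fejer n x y) - g x| <= e.
Proof.
move=> Ux e0; have mU := @measurable_unit_cube R d.
have e20 : 0 < e / 2 by rewrite divr_gt0.
have [C C0 HC] := periodic_modulus cg pg Ux e20.
exists (Num.bound (C * d%:R / (e / 2))) => n mn.
have n0 : (0 < n)%N by apply: leq_ltn_trans mn.
have iK := integrable_fejer n x.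
have igK := integrable_continuousM iK.
have igxK : (cube_measure d).-integrable (unit_cube d)
    (EFin \o (fun y => g x * fejer n x y)).
  by have := integrableZl mU (g x) iK; apply: eq_integrable.
have idiff : (cube_measure d).-integrable (unit_cube d)
    (EFin \o (fun y => g y * fejer n x y - g x * fejer n x y)).
  by have := integrableB mU igK igxK; apply: eq_integrable.
have icos j : (cube_measure d).-integrable (unit_cube d)
    (EFin \o (fun y => fejer n x y * (1 - cos (2 * pi * (tnth x j - tnth y j))))).
  pose h (y : d.-tuple R) := 1 - cos (2 * pi * (tnth x j - tnth y j)).
  have mh : measurable_fun (unit_cube d) h.
    apply: measurable_funTS; apply: measurable_funB => //.
    apply: (measurableT_comp (continuous_measurable_fun (@continuous_cos R))).
    apply: measurable_funM => //; apply: measurable_funB => //.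
    exact: measurable_tnth.
  have bh : [bounded h y | y in unit_cube d].
    exists 2; split; first exact: num_real.
    move=> M M2 y _ /=; apply: (le_trans _ (ltW M2)).
    have := cos_le1 (2 * pi * (tnth x j - tnth y j)).
    have := cos_geN1 (2 * pi * (tnth x j - tnth y j)).
    by rewrite /h ler_norml; lra.
  by have := integrableMl mU iK mh bh; apply: eq_integrable.
pose H y := e / 2 * fejer n x y +
   C * \sum_(j < d) (fejer n x y * (1 - cos (2 * pi * (tnth x j - tnth y j)))).
have is' : (cube_measure d).-integrable (unit_cube d)
    (EFin \o (fun y => \sum_(j < d) (fejer n x y * (1 - cos (2 * pi * (tnth x j - tnth y j)))))).
  have := integrable_sum mU (index_enum 'I_d) (P := xpredT) (fun j _ => icos j).
  by apply: eq_integrable => // y _; rewrite /= sumEFin.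
have iCs : (cube_measure d).-integrable (unit_cube d)
    (EFin \o (fun y => C * \sum_(j < d)
      (fejer n x y * (1 - cos (2 * pi * (tnth x j - tnth y j)))))).
  by have := integrableZl mU C is'; apply: eq_integrable.
have ieK : (cube_measure d).-integrable (unit_cube d)
    (EFin \o (fun y => e / 2 * fejer n x y)).
  by have := integrableZl mU (e / 2) iK; apply: eq_integrable.
have iH : (cube_measure d).-integrable (unit_cube d) (EFin \o H).
  by have := integrableD mU ieK iCs; apply: eq_integrable.
have -> : g x = \int[cube_measure d]_(y in unit_cube d) (g x * fejer n x y).
  by rewrite (RintegralZl _ mU iK) fejer_integral// mulr1.
rewrite -RintegralB//.
apply: (le_trans (le_normr_Rintegral mU idiff)).
apply: (@le_trans _ _ (\int[cube_measure d]_(y in unit_cube d) H y)).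
  apply: le_Rintegral => //.
    have := integrable_norm idiff; exact.
  move=> y Uy; rewrite -mulrBl normrM (ger0_norm (fejer_ge0 _ _ _)) /H.
  rewrite -mulr_sumr [fejer n x y * \sum_(_ < _) _]mulrC [C * (_ * _)]mulrA -mulrDl.
  by rewrite ler_wpM2r ?fejer_ge0// HC.
rewrite /H RintegralD// (RintegralZl _ mU iK) (RintegralZl _ mU is').
rewrite cube_Rintegral_sum// fejer_integral//.
under eq_bigr do rewrite fejer_integral_onemcos//.
rewrite sumr_const card_ord -[_ *+ d]mulr_natl mulrA mulr1.
rewrite [leRHS](splitr e) lerD2l ler_pdivrMr ?ltr0n// -ler_pdivrMl// mulrC.
apply: le_trans (ltW (archi_boundP _)) _; last by rewrite ler_nat ltnW.
by rewrite divr_ge0 ?mulr_ge0// ltW.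
Qed.

End Real.

Variable f : d.-tuple R -> R[i].
Hypothesis cf : continuous_tuple f.
Hypothesis pf : periodic1 f.

Let f1 (x : d.-tuple R) : R := complex.Re (f x).
Let f2 (x : d.-tuple R) : R := complex.Im (f x).
Let cf1 : continuous (fun v : 'rV[R]_d => f1 [tuple v ord0 j | j < d]) := cf.1.
Let cf2 : continuous (fun v : 'rV[R]_d => f2 [tuple v ord0 j | j < d]) := cf.2.

Lemma measurable_phase_comp (F : R -> R) (c : R) (k : d.-tuple int) (D : set (d.-tuple R)) :
  continuous F -> measurable_fun D (fun y => F (c - phase k y)).
Proof.
move=> cF; apply: measurable_funTS.
apply: (measurableT_comp (continuous_measurable_fun cF)).
by apply: measurable_funB => //; exact: measurable_phase.
Qed.

Lemma integrable_cosB (c : R) (k : d.-tuple int) :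
  (cube_measure d).-integrable (unit_cube d) (EFin \o (fun y => cos (c - phase k y))).
Proof.
apply: (@cube_integrable _ _ _ 1) => [|y _]; last exact: cos_max.
by apply: measurable_phase_comp; exact: continuous_cos.
Qed.

Lemma integrable_sinB (c : R) (k : d.-tuple int) :
  (cube_measure d).-integrable (unit_cube d) (EFin \o (fun y => sin (c - phase k y))).
Proof.
apply: (@cube_integrable _ _ _ 1) => [|y _]; last exact: sin_max.
by apply: measurable_phase_comp; exact: continuous_sin.
Qed.

Lemma fourier_coefM_expi (k : d.-tuple int) (x : d.-tuple R) :
  fourier_coef f k * expi (phase k x) =
  Complex
   (\int[cube_measure d]_(y in unit_cube d) (f1 y * cos (phase k x - phase k y) -
      f2 y * sin (phase k x - phase k y)))
   (\int[cube_measure d]_(y in unit_cube d) (f1 y * sin (phase k x - phase k y) +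
      f2 y * cos (phase k x - phase k y))).
Proof.
have mU := @measurable_unit_cube R d.
pose G1 y := f1 y * cos (0 - phase k y) - f2 y * sin (0 - phase k y).
pose G2 y := f1 y * sin (0 - phase k y) + f2 y * cos (0 - phase k y).
have ic c := integrable_cosB c k.
have is_ c := integrable_sinB c k.
have i1c c := integrable_continuousM cf1 (ic c).
have i1s c := integrable_continuousM cf1 (is_ c).
have i2c c := integrable_continuousM cf2 (ic c).
have i2s c := integrable_continuousM cf2 (is_ c).
have iG1 : (cube_measure d).-integrable (unit_cube d) (EFin \o G1).
  by have := integrableB mU (i1c 0) (i2s 0); apply: eq_integrable.
have iG2 : (cube_measure d).-integrable (unit_cube d) (EFin \o G2).
  by have := integrableD mU (i1s 0) (i2c 0); apply: eq_integrable.
have -> : fourier_coef f k = Complex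
    (\int[cube_measure d]_(y in unit_cube d) G1 y)
    (\int[cube_measure d]_(y in unit_cube d) G2 y).
  congr Complex; apply: eq_Rintegral => y _; rewrite /G1 /G2 sub0r /f1 /f2 /phase /=;
    by case: (f y).
rewrite /expi /=.
set a := phase k x.
have iG1c c : (cube_measure d).-integrable (unit_cube d) (EFin \o (fun y => G1 y * c)).
  by have := integrableZr mU c iG1; apply: eq_integrable.
have iG2c c : (cube_measure d).-integrable (unit_cube d) (EFin \o (fun y => G2 y * c)).
  by have := integrableZr mU c iG2; apply: eq_integrable.
transitivity (Complex
  (\int[cube_measure d]_(y in unit_cube d) (G1 y * cos a - G2 y * sin a))
  (\int[cube_measure d]_(y in unit_cube d) (G1 y * sin a + G2 y * cos a))).
  rewrite (RintegralB mU (iG1c _) (iG2c _)) (RintegralD mU (iG1c _) (iG2c _)).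
  by rewrite !(RintegralZr _ mU iG1) !(RintegralZr _ mU iG2).
congr Complex; apply: eq_Rintegral => y _; rewrite /G1 /G2.
  by rewrite sub0r sinN cosN sinB cosB; ring.
by rewrite sub0r sinN cosN sinB cosB; ring.
Qed.

(** A frequency k occurs once for each pair with difference k. The usual weights, the products of 1
    - |k_j|/n, are left ungrouped since the pairs serve both the kernel and the tail estimate. *)
Definition fejer_mean (n : nat) (x : d.-tuple R) : R[i] :=
  \sum_(p : {ffun 'I_d -> 'I_n} * {ffun 'I_d -> 'I_n})
    ((n%:R ^+ d)^-1)%:C%C * (fourier_coef f (freqdiff p) * expi (phase (freqdiff p) x)).

Lemma fejer_meanE (n : nat) (x : d.-tuple R) : fejer_mean n x =
  Complex (\int[cube_measure d]_(y in unit_cube d) (f1 y * fejer n x y))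
          (\int[cube_measure d]_(y in unit_cube d) (f2 y * fejer n x y)).
Proof.
have mU := @measurable_unit_cube R d.
set c : R := (n%:R ^+ d)^-1.
pose FF := {ffun 'I_d -> 'I_n}.
pose th (p : FF * FF) y :=
  phase (freqdiff p) x - phase (freqdiff p) y.
(* Exchanging the members of each pair changes the sign of the sine. The kernel is thus real, and
   the real and imaginary parts of [f] are averaged separately. *)
have sin0 y : \sum_p sin (th p y) = 0.
  have E : \sum_p sin (th p y) = - \sum_p sin (th p y).
    rewrite [LHS](reindex_inj (h := fun p : FF * FF => (p.2, p.1))) /=; last first.
      by move=> [a b] [a' b'] [-> ->].
    rewrite -sumrN; apply: eq_bigr => p _; rewrite -sinN; congr sin.
    have H z : phase (freqdiff (p.2, p.1)) z = - phase (freqdiff p) z :> R.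
      rewrite /phase -mulrN -sumrN; congr (_ * _); apply: eq_bigr => j _.
      by rewrite !tnth_mktuple -opprB intrN mulNr.
    by rewrite /th !H opprB opprK addrC.
  by move: E => /eqP; rewrite -addr_eq0 -mulr2n mulrn_eq0 => /eqP.
have ic (p : FF * FF) := integrable_cosB (phase (freqdiff p) x) (freqdiff p).
have is_ (p : FF * FF) := integrable_sinB (phase (freqdiff p) x) (freqdiff p).
have i1c p := integrable_continuousM cf1 (ic p).
have i1s p := integrable_continuousM cf1 (is_ p).
have i2c p := integrable_continuousM cf2 (ic p).
have i2s p := integrable_continuousM cf2 (is_ p).
have iRe p : (cube_measure d).-integrable (unit_cube d)
    (EFin \o (fun y => c * (f1 y * cos (th p y) - f2 y * sin (th p y)))).
  have := integrableZl mU c (integrableB mU (i1c p) (i2s p)).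
  by apply: eq_integrable.
have iIm p : (cube_measure d).-integrable (unit_cube d)
    (EFin \o (fun y => c * (f1 y * sin (th p y) + f2 y * cos (th p y)))).
  have := integrableZl mU c (integrableD mU (i1s p) (i2c p)).
  by apply: eq_integrable.
transitivity (Complex
   (\sum_p \int[cube_measure d]_(y in unit_cube d)
      (c * (f1 y * cos (th p y) - f2 y * sin (th p y))))
   (\sum_p \int[cube_measure d]_(y in unit_cube d)
      (c * (f1 y * sin (th p y) + f2 y * cos (th p y))))).
  rewrite /fejer_mean; elim/big_rec3: _ => [//|p z1 z2 z3 _ ->].
  rewrite fourier_coefM_expi -/c.
  have i1 : (cube_measure d).-integrable (unit_cube d)
      (EFin \o (fun y => f1 y * cos (th p y) - f2 y * sin (th p y))).
    by have := integrableB mU (i1c p) (i2s p); apply: eq_integrable.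
  have i2 : (cube_measure d).-integrable (unit_cube d)
      (EFin \o (fun y => f1 y * sin (th p y) + f2 y * cos (th p y))).
    by have := integrableD mU (i1s p) (i2c p); apply: eq_integrable.
  rewrite (RintegralZl _ mU i1) (RintegralZl _ mU i2) /real_complex_def.
  by congr Complex; rewrite /= ?mul0r ?subr0 ?addr0.
congr Complex; rewrite -cube_Rintegral_sum//; apply: eq_Rintegral => y _.
  rewrite -mulr_sumr sumrB -!mulr_sumr sin0 mulr0 subr0 mulrCA.
  by rewrite /fejer.
rewrite -mulr_sumr big_split /= -!mulr_sumr sin0 mulr0 add0r mulrCA.
by rewrite /fejer.
Qed.

Lemma fejer_mean_cvg (x : d.-tuple R) (e : R) : unit_cube d x -> 0 < e ->
  exists m, forall n, (m < n)%N -> Normc.normc (fejer_mean n x - f x) <= e.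
Proof.
move=> Ux e0; have e20 : 0 < e / 2 by rewrite divr_gt0.
have pf1 y j : f1 [tuple tnth y i + (i == j)%:R | i < d] = f1 y by rewrite /f1 pf.
have pf2 y j : f2 [tuple tnth y i + (i == j)%:R | i < d] = f2 y by rewrite /f2 pf.
have [m1 H1] := fejer_mean_near cf1 pf1 Ux e20.
have [m2 H2] := fejer_mean_near cf2 pf2 Ux e20.
exists (maxn m1 m2) => n; rewrite gtn_max => /andP[/H1 {}H1 /H2 {}H2].
rewrite fejer_meanE.
have -> : f x = Complex (f1 x) (f2 x) by rewrite /f1 /f2; case: (f x).
rewrite /=; move: H1 H2.
set a := _ - f1 x; set b := _ - f2 x => H1 H2.
rewrite -(ger0_norm (ltW e0)) -sqrtr_sqr ler_wsqrtr// -[a ^+ 2]real_normK ?num_real//.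
rewrite -[b ^+ 2]real_normK ?num_real//.
have := normr_ge0 a; have := normr_ge0 b; nra.
Qed.

End FejerMeans.

(** * Lattice generators *)

Section LatticeGenerator.

Lemma card_modn_eq (N h r : nat) : (0 < h)%N ->
  (#|[set t : 'I_N | (h * t) %% N == r]%N%SET| <= h)%N.
Proof.
case: h => // h _; pose f (t : 'I_N) : 'I_h.+1 := inord (h.+1 * t %/ N).
suff f_inj : {in [set t : 'I_N | (h.+1 * t) %% N == r]%N%SET &, injective f}.
  by rewrite -(card_in_imset f_inj) -[leqRHS]card_ord max_card.
move=> s t; rewrite !inE => /eqP Hs /eqP Ht /(congr1 val) /=.
have N0 : (0 < N)%N by apply: leq_ltn_trans (ltn_ord s).
have lt (u : 'I_N) : (h.+1 * u %/ N < h.+1)%N by rewrite ltn_divLR// ltn_pmul2l.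
rewrite !inordK// => E; apply/val_inj/eqP; rewrite /= -(eqn_pmul2l (ltn0Sn h)).
by rewrite (divn_eq (h.+1 * s) N) (divn_eq (h.+1 * t) N) E Hs Ht.
Qed.

(* Modulo [N], [h * t] is the same for all solutions [t], and [h * t %/ N]
   determines [t] and takes at most [`|h|] values. *)
Lemma card_dvdz_affine (N : nat) (c h : int) : h != 0 ->
  (#|[set t : 'I_N | (N %| (c + h * t%:Z)%R)%Z]%SET| <= `|h|)%N.
Proof.
move=> h0; set S := finset _.
have [->|[t0 St0]] := set_0Vmem S; first by rewrite cards0.
apply: leq_trans (card_modn_eq N (`|h| * t0 %% N) _); last by rewrite absz_gt0.
apply: subset_leq_card; apply/fintype.subsetP => t St; rewrite inE.
move: St0 St; rewrite !inE => H0 H1.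
have : (N %| h * t%:Z - h * t0%:Z)%Z.
  have -> : h * t%:Z - h * t0%:Z = (c + h * t%:Z) - (c + h * t0%:Z) by ring.
  exact: rpredB.
(* Multiplying by the sign of [h] replaces it by its absolute value and leaves a congruence of
   natural numbers. *)
move=> /(dvdz_mull ((-1) ^+ (h < 0)%R)); rewrite mulrBr !mulrA -abszEsign -!PoszM.
by rewrite -eqz_mod_dvd !modz_nat.
Qed.

Lemma card_has_le (T : finType) (I : eqType) (s : seq I) (P : I -> pred T) (B : nat) :
  (forall i, i \in s -> (#|[set t | P i t]%SET| <= B)%N) ->
  (#|[set t | has (P^~ t) s]%SET| <= size s * B)%N.
Proof.
elim: s => [|i s IH] H.
  by rewrite leqn0 cards_eq0; apply/eqP/setP => t; rewrite !inE.
have -> : [set t | has (P^~ t) (i :: s)]%SET = ([set t | P i t] :|: [set t | has (P^~ t) s])%SET.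
  by apply/setP => t; rewrite !inE.
apply: leq_trans (leq_card_setU _ _) _.
rewrite mulSn leq_add ?H ?mem_head// IH// => j js.
by apply: H; rewrite inE js orbT.
Qed.

(* Component by component: the first [m] components of [z] already work for all
   [h] that do not vanish on the first [m] coordinates. *)
Lemma lattice_generator (d N B : nat) (D : seq (d.-tuple int)) :
  (forall h, h \in D -> exists j, tnth h j != 0) ->
  (forall h j, h \in D -> (`|tnth h j| <= B)%N) ->
  (size D * B < N)%N ->
  exists z : 'I_d -> nat, forall h, h \in D ->
    ~~ (N %| \sum_(j < d) tnth h j * (z j)%:Z)%Z.
Proof.
move=> D0 DB DN.
have [z Hz] : exists z : 'I_d -> nat, forall h, h \in D ->
    (exists2 j : 'I_d, (j < d)%N & tnth h j != 0) ->
    ~~ (N %| \sum_(j < d | (j < d)%N) tnth h j * (z j)%:Z)%Z; last first.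
  exists z => h hD; have [j hj] := D0 h hD.
  have := Hz h hD (ex_intro2 _ _ j (ltn_ord j) hj).
  by rewrite (eq_bigl xpredT) // => i; rewrite ltn_ord.
have H m : (m <= d)%N -> exists z : 'I_d -> nat, forall h, h \in D ->
    (exists2 j : 'I_d, (j < m)%N & tnth h j != 0) ->
    ~~ (N %| \sum_(j < d | (j < m)%N) tnth h j * (z j)%:Z)%Z; last exact: H.
elim: m => [_|m IH md]; first by exists (fun=> 0%N) => h hD [].
have [z Hz] := IH (ltnW md); pose jm := Ordinal md.
pose c h : int := \sum_(j < d | (j < m)%N) tnth h j * (z j)%:Z.
pose bad h (t : 'I_N) := (tnth h jm != 0) && (N %| c h + tnth h jm * t%:Z)%Z.
(* A choice of the new component can only fail for an [h] with a nonzero component there, at most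
   [B] residues for each [h]; since [size D * B < N], one residue is good for all of [D]. *)
have /subsetPn[t _] : ~~ ([set: 'I_N]%SET \subset [set t | has (bad^~ t) D]%SET).
  apply/negP => /subset_leq_card; rewrite cardsT card_ord leqNgt => /negP; apply.
  apply: leq_ltn_trans DN; apply: card_has_le => h hD.
  have [h0|h0] := eqVneq (tnth h jm) 0.
    rewrite (_ : finset _ = finset.set0) ?cards0//.
    by apply/setP => t; rewrite !inE /bad h0 eqxx.
  apply: leq_trans (DB h jm hD); apply: leq_trans (card_dvdz_affine N (c h) h0).
  by apply: subset_leq_card; apply/fintype.subsetP => t; rewrite !inE /bad => /andP[].
rewrite inE => /hasPn Ht.
exists (fun j => if j == jm then (t : nat) else z j) => h hD [j jm1 hj].
have -> : \sum_(j < d | (j < m.+1)%N) tnth h j * (if j == jm then (t : nat) else z j)%:Z =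
    c h + tnth h jm * t%:Z.
  rewrite (bigD1 jm) /=; last by rewrite ltnS.
  rewrite eqxx addrC; congr (_ + _); apply: eq_big => [i|i /andP[_ /negbTE ->]//].
  by rewrite -val_eqE /= ltnS andbC -ltn_neqAle.
have := Ht h hD; rewrite /bad negb_and negbK => /orP[/eqP h0|//].
rewrite h0 mul0r addr0; apply: Hz => //; exists j => //.
move: jm1; rewrite ltnS leq_eqVlt => /predU1P[E|//].
by move: hj; rewrite (_ : j = jm) ?h0 ?eqxx//; apply: val_inj.
Qed.

End LatticeGenerator.

(** * The lattice algorithm *)

Section LatticeAlgorithm.
Context {R : realType}.
Local Notation normc := Normc.normc.

Lemma expiD (a b : R) : expi (a + b) = expi a * expi b.
Proof. by rewrite /expi cosD sinD; congr Complex; ring. Qed.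

Lemma expi0 : expi 0 = 1 :> R[i].
Proof. by rewrite /expi cos0 sin0. Qed.

Lemma expiD2piz (a : R) (z : int) : expi (a + 2 * pi * z%:~R) = expi a.
Proof. by rewrite /expi cosD2piz sinD2piz. Qed.

Lemma normc_expi (a : R) : normc (expi a) = 1.
Proof. by rewrite /= cos2Dsin2 sqrtr1. Qed.

Lemma normc_sum (I : Type) (s : seq I) (P : pred I) (F : I -> R[i]) :
  normc (\sum_(i <- s | P i) F i) <= \sum_(i <- s | P i) normc (F i).
Proof.
apply: (big_ind2 (fun (a : R[i]) (b : R) => normc a <= b)) => //.
  by rewrite Normc.normc0.
by move=> a b a' b' H1 H2; apply: (le_trans (le_normcD _ _)); exact: lerD.
Qed.

(** With [r] the nonzero remainder of [q], the angle is twice [t = pi r / N], which lies strictly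
    between 0 and pi; a cosine equal to 1 would force [sin t = 0]. *)
Lemma expi_neq1 (q : int) (N : nat) : (0 < N)%N -> ~~ (N %| q)%Z ->
  expi (2 * pi * (q%:~R / N%:R)) != 1 :> R[i].
Proof.
move=> N0 Nq; have N0R : 0 < N%:R :> R by rewrite ltr0n.
have -> : 2 * pi * (q%:~R / N%:R) =
    2 * pi * ((q %% N)%Z%:~R / N%:R) + 2 * pi * (q %/ N)%Z%:~R :> R.
  rewrite {1}(divz_eq q N) intrD intrM -pmulrn.
  by field; rewrite gt_eqF.
rewrite expiD2piz.
have r0 : (0 < (q %% N)%Z)%R.
  have rge : (0 <= (q %% N)%Z)%R by rewrite modz_ge0// eqz_nat -lt0n.
  rewrite lt_def rge andbT.
  by apply: contra Nq => /eqP H; apply/dvdz_mod0P.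
have rN : ((q %% N)%Z < N%:Z)%R by rewrite ltz_pmod ?ltz_nat.
set r := (q %% N)%Z in r0 rN *.
apply/eqP => /(congr1 (@complex.Re R)) /= C1.
pose t : R := pi * (r%:~R / N%:R).
have tE : 2 * pi * (r%:~R / N%:R) = t *+ 2 by rewrite /t -mulr_natl; ring.
have t0 : 0 < t < pi.
  rewrite /t mulr_gt0 ?pi_gt0 ?divr_gt0 ?ltr0z//=.
  by rewrite -[ltRHS]mulr1 ltr_pM2l ?pi_gt0// ltr_pdivrMr// mul1r pmulrn ltr_int.
have s0 := sin_gt0_pi t0.
move: C1; rewrite tE cos_mulr2n cos2sin2 -mulr_natl => C1.
have : sin t ^+ 2 = 0 by lra.
by move/eqP; rewrite sqrf_eq0 gt_eqF.
Qed.

Lemma sum_expi (q : int) (N : nat) : (0 < N)%N ->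
  \sum_(i < N) expi (2 * pi * (i%:R * q%:~R / N%:R)) =
  ((N %| q)%Z * N)%N%:R :> R[i].
Proof.
move=> N0; have N0R : N%:R != 0 :> R by rewrite pnatr_eq0 -lt0n.
pose w : R[i] := expi (2 * pi * (q%:~R / N%:R)).
have wE i : expi (2 * pi * (i%:R * q%:~R / N%:R)) = w ^+ i.
  elim: i => [|i IH]; first by rewrite !mul0r mulr0 expi0.
  rewrite exprS -IH /w -expiD; congr expi; rewrite -natr1; ring.
under eq_bigr do rewrite wE.
have [/dvdzP[m qE]|Nq] := boolP (N %| q)%Z.
  have -> : w = 1.
    rewrite /w -[RHS]expi0 -[RHS](expiD2piz _ m) add0r; congr (expi (_ * _)).
    by rewrite qE intrM -pmulrn mulfK.
  by under eq_bigr do rewrite expr1n; rewrite sumr_const card_ord mul1n.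
have w1 := expi_neq1 N0 Nq; rewrite -/w in w1.
have := subrX1 w N; have -> : w ^+ N = 1.
  rewrite -wE -[RHS]expi0 -[RHS](expiD2piz _ q) add0r; congr (expi (_ * _)).
  by rewrite mulrC mulKf.
rewrite subrr mul0n => /esym/eqP; rewrite mulf_eq0 subr_eq0 (negbTE w1) /=.
by move/eqP.
Qed.

Variables (d N : nat) (z : 'I_d -> nat) (A : seq (d.-tuple int)).
Hypothesis N0 : (0 < N)%N.
Hypothesis uA : uniq A.
Hypothesis Hz : forall k k', k \in A -> k' \in A -> k != k' ->
  ~~ (N %| \sum_(j < d) (tnth k j - tnth k' j) * (z j)%:Z)%Z.

Let N0R : N%:R != 0 :> R. Proof. by rewrite pnatr_eq0 -lt0n. Qed.
Let N0C : N%:R != 0 :> R[i].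
Proof. by rewrite pnatr_eq0 -lt0n. Qed.

Definition lattice_node (i : 'I_N) : d.-tuple R :=
  [tuple ((i * z j) %% N)%N%:R / N%:R | j < d].

Lemma lattice_node_in_cube (i : 'I_N) : unit_cube d (lattice_node i).
Proof.
move=> j; rewrite tnth_mktuple divr_ge0//= ler_pdivrMr ?ltr0n// mul1r ler_nat.
by rewrite ltnW// ltn_mod.
Qed.

(** The inner average is the equal-weight lattice rule for the Fourier coefficient at [k]. *)
Definition lattice_reconstruct (v : 'I_N -> R[i]) (x : d.-tuple R) : R[i] :=
  \sum_(k <- A) (N%:R^-1 * \sum_i v i * expi (- phase k (lattice_node i))) *
    expi (phase k x).

Lemma expi_phase_node (k : d.-tuple int) (i : 'I_N) :
  expi (phase k (lattice_node i)) =
  expi (2 * pi * (i%:R * (\sum_(j < d) tnth k j * (z j)%:Z)%:~R / N%:R)) :> R[i].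
Proof.
(* The added multiple of 2 pi undoes the reduction modulo [N] in the nodes. *)
rewrite -(expiD2piz (phase k _) (\sum_(j < d) tnth k j * ((i * z j) %/ N)%:Z)).
congr expi; rewrite /phase -mulrDr !rmorph_sum /= -big_split /=; congr (_ * _).
rewrite mulr_sumr mulr_suml; apply: eq_bigr => j _.
rewrite tnth_mktuple !intrM -!pmulrn.
have := divn_eq (i * z j) N => /(congr1 (fun n => n%:R : R)).
rewrite natrD !natrM => E.
by rewrite (mulrCA i%:R) E; field.
Qed.

Lemma lattice_reconstruct_expi (m : d.-tuple int) (x : d.-tuple R) :
  lattice_reconstruct (fun i => expi (phase m (lattice_node i))) x =
  \sum_(k <- A) (N %| \sum_(j < d) (tnth m j - tnth k j) * (z j)%:Z)%Z%:R *
    expi (phase k x).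
Proof.
rewrite /lattice_reconstruct; apply: eq_bigr => k _; congr (_ * _).
under eq_bigr do rewrite -expiD -phaseB expi_phase_node.
under eq_bigr do under eq_bigr do rewrite tnth_mktuple.
by rewrite sum_expi// natrM mulrCA mulVf ?mulr1.
Qed.

Lemma lattice_reconstruct_sum (I : Type) (s : seq I) (c : I -> R[i])
    (w : I -> 'I_N -> R[i]) (x : d.-tuple R) :
  lattice_reconstruct (fun i => \sum_(p <- s) c p * w p i) x =
  \sum_(p <- s) c p * lattice_reconstruct (w p) x.
Proof.
rewrite /lattice_reconstruct; under [RHS]eq_bigr do rewrite mulr_sumr.
rewrite exchange_big /=; apply: eq_bigr => k _.
under eq_bigr do rewrite mulr_suml.
rewrite exchange_big /= mulr_sumr mulr_suml; apply: eq_bigr => p _.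
rewrite !mulr_sumr !mulr_suml mulr_sumr; apply: eq_bigr => i _; ring.
Qed.

(** The factor [size A] is harmless: this serves to replace Fejer means by [f] at the nodes, with
    [e] as small as desired. *)
Lemma normc_lattice_reconstructB (v w : 'I_N -> R[i]) (e : R) (x : d.-tuple R) :
  (forall i, normc (v i - w i) <= e) ->
  normc (lattice_reconstruct v x - lattice_reconstruct w x) <= (size A)%:R * e.
Proof.
move=> vw; rewrite /lattice_reconstruct -sumrB.
apply: (le_trans (normc_sum _ _ _)).
rewrite -sum1_size natr_sum mulr_suml; apply: ler_sum => k _; rewrite mul1r.
rewrite -mulrBl -mulrBr -sumrB Normc.normcM normc_expi mulr1 Normc.normcM.
have -> : normc (N%:R^-1 : R[i]) = N%:R^-1.
  rewrite Normc.normcV; congr (_^-1).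
  by rewrite normcMn Normc.normc1.
rewrite mulrC ler_pdivrMr ?ltr0n//.
apply: (le_trans (normc_sum _ _ _)).
apply: (@le_trans _ _ (\sum_(i < N) e)).
  by apply: ler_sum => i _; rewrite -mulrBl Normc.normcM normc_expi mulr1.
by rewrite sumr_const card_ord mulr_natr.
Qed.

(* A frequency [m], in [A] or not, is aliased to at most one frequency of [A]. *)
Lemma lattice_alias (m k k' : d.-tuple int) : k \in A -> k' \in A ->
  (N %| \sum_(j < d) (tnth m j - tnth k j) * (z j)%:Z)%Z ->
  (N %| \sum_(j < d) (tnth m j - tnth k' j) * (z j)%:Z)%Z -> k = k'.
Proof.
move=> kA k'A H H'; apply/eqP; apply: contraT => kk'.
have := Hz kA k'A kk'.
have -> : \sum_(j < d) (tnth k j - tnth k' j) * (z j)%:Z =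
   \sum_(j < d) (tnth m j - tnth k' j) * (z j)%:Z -
   \sum_(j < d) (tnth m j - tnth k j) * (z j)%:Z.
  by rewrite -sumrB; apply: eq_bigr => j _; ring.
by rewrite rpredB.
Qed.

(** A frequency of [A] is its own only alias and is reproduced exactly. For any other frequency the
    output is zero or a single exponential, so two unimodular terms remain at most. *)
Lemma normc_lattice_error_expi (m : d.-tuple int) (x : d.-tuple R) :
  normc (expi (phase m x) -
    lattice_reconstruct (fun i => expi (phase m (lattice_node i))) x) <=
  2 * (m \notin A)%:R.
Proof.
rewrite lattice_reconstruct_expi.
set b := fun k : d.-tuple int => (N %| \sum_(j < d) (tnth m j - tnth k j) * (z j)%:Z)%Z.
rewrite -/(\sum_(k <- A) (b k)%:R * _).
have E k : k \in A -> b k ->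
    \sum_(l <- A) (b l)%:R * expi (phase l x) = expi (phase k x) :> R[i].
  move=> kA bk; rewrite (bigD1_seq k)//= bk mul1r big_seq_cond big1 ?addr0//.
  move=> l /andP[lA lk]; have -> : b l = false; last by rewrite mul0r.
  by apply: contraNF lk => bl; apply/eqP; exact: lattice_alias lA kA bl bk.
have [mA|mA] := boolP (m \in A).
  rewrite (E m)//; last by rewrite /b big1 ?dvdz0// => j _; rewrite subrr mul0r.
  by rewrite subrr Normc.normc0 mulr0.
rewrite mulr1; have [/hasP[k kA bk]|/hasPn nb] := boolP (has b A).
  rewrite (E k kA bk); apply: (le_trans (le_normcD _ _)).
  by rewrite normcN !normc_expi.
rewrite big_seq big1 ?subr0 ?normc_expi ?ler1n// => k kA.
by rewrite (negbTE (nb k kA)) mul0r.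
Qed.

Lemma normc_lattice_error_sum (I : Type) (s : seq I) (c : I -> R[i])
    (h : I -> d.-tuple int) (x : d.-tuple R) :
  normc (\sum_(p <- s) c p * expi (phase (h p) x) -
    lattice_reconstruct (fun i => \sum_(p <- s) c p * expi (phase (h p) (lattice_node i))) x) <=
  2 * \sum_(p <- s | h p \notin A) normc (c p).
Proof.
rewrite (lattice_reconstruct_sum s c (fun p i => expi (phase (h p) (lattice_node i)))).
rewrite -sumrB; apply: (le_trans (normc_sum _ _ _)).
rewrite [X in 2 * X]big_mkcond mulr_sumr; apply: ler_sum => p _.
rewrite -mulrBr Normc.normcM.
apply: (@le_trans _ _ (normc (c p) * (2 * (h p \notin A)%:R))).
  apply: ler_wpM2l; last exact: normc_lattice_error_expi.
  by case: (c p) => a b; exact: sqrtr_ge0.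
by case: (h p \in A); rewrite /= ?mulr0 ?mulr1 // mulrC.
Qed.

End LatticeAlgorithm.

Lemma sum_le_esum (R : realType) (I : choiceType) (D : set I) (a : I -> \bar R)
    (s : seq I) : uniq s -> (forall i, i \in s -> D i) ->
  (\sum_(i <- s) a i <= \esum_(i in D) a i)%E.
Proof.
move=> us sD; apply: ereal_sup_ubound; exists [set` s].
  by split; [exact: finite_seq|move=> i /= /sD].
by rewrite -fsbig_seq.
Qed.

(** * Summation of the weights *)

Section Zeta.
Context {R : realType}.
Variable s : R.
Hypothesis s1 : 1 < s.

Let q : R := 2 `^ (1 - s).

Let q0 : 0 < q. Proof. exact: powR_gt0. Qed.

Let q1 : q < 1.
Proof.
have s10 : 0 < s - 1 by rewrite subr_gt0.
rewrite /q -(opprB s) powRN invf_lt1 ?powR_gt0//.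
have := gt0_ltr_powR s10 (x := 1) (y := 2).
by rewrite powR1; apply; rewrite ?nnegrE// ltr1n.
Qed.

(* Cauchy condensation. *)
Let dyadic_bound (n : nat) :
  \sum_(1 <= m < 2 ^ n) m%:R `^ (- s) <= (1 - q ^+ n) / (1 - q).
Proof.
have q10 : 0 < 1 - q by rewrite subr_gt0.
elim: n => [|n IH]; first by rewrite big_geq// expr0 subrr mul0r.
rewrite (@big_cat_nat _ _ _ (2 ^ n))/= ?expn_gt0 ?leq_exp2l//.
have -> : (1 - q ^+ n.+1) / (1 - q) = (1 - q ^+ n) / (1 - q) + q ^+ n.
  by rewrite exprS; field; rewrite gt_eqF.
apply: lerD => //.
apply: (@le_trans _ _ (\sum_(2 ^ n <= m < 2 ^ n.+1) (2 ^ n)%N%:R `^ (- s))).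
  apply: ler_sum_nat => m /andP[nm _].
  rewrite !powRN lef_pV2 ?posrE ?powR_gt0 ?ltr0n ?expn_gt0//; last first.
    by apply: leq_trans nm; rewrite expn_gt0.
  by apply: ge0_ler_powR; rewrite ?nnegrE ?ler_nat// ltW// (lt_trans ltr01).
rewrite sumr_const_nat expnS mul2n -addnn addnK -(mulr_natl (_ `^ _)).
have -> : q ^+ n = (2 ^ n)%N%:R `^ (1 - s).
  by rewrite -powR_mulrn ?ltW// /q powRAC natrX powR_mulrn.
rewrite powRD; last by apply/implyP => _; rewrite pnatr_eq0 -lt0n expn_gt0.
by rewrite powRr1.
Qed.

(** [zeta] is defined as a [limn], which bounds the partial sums only once they are known to
    converge; the dyadic bound provides this. *)
Lemma zeta_ge_partial (K : nat) : \sum_(1 <= m < K.+1) m%:R `^ (- s) <= zeta s.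
Proof.
pose u (n : nat) : R := \sum_(1 <= m < n.+1) m%:R `^ (- s).
have nu : nondecreasing_seq u.
  apply/nondecreasing_seqP => n; rewrite /u [leRHS]big_nat_recr//= lerDl.
  exact: powR_ge0.
apply: (nondecreasing_cvgn_le nu); apply: nondecreasing_is_cvgn => //.
exists (1 / (1 - q)) => _ [n _ <-].
have n2 : (n.+1 <= 2 ^ n)%N by rewrite ltn_expl.
apply: (@le_trans _ _ (\sum_(1 <= m < 2 ^ n) m%:R `^ (- s))).
  rewrite [leRHS](@big_cat_nat _ _ _ n.+1)//= lerDl.
  by apply: sumr_ge0 => m _; exact: powR_ge0.
apply: (le_trans (dyadic_bound n)).
rewrite ler_pM2r ?invr_gt0 ?subr_gt0// lerBlDr lerDl.
by rewrite exprn_ge0// ltW.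
Qed.

Lemma zeta_ge1 : 1 <= zeta s.
Proof.
by apply: le_trans (zeta_ge_partial 1); rewrite big_nat1 powR1.
Qed.

End Zeta.

Section WeightSum.
Context {R : realType}.
Variables (alpha lambda : R) (gamma : {fset nat} -> R).
Hypothesis al1 : 1 < alpha * lambda.

(** This is r^(-lambda), written so that for positive [lambda] it is 0 when [gamma (supp k)]
    vanishes and r is infinite. *)
Definition weight (d : nat) (k : d.-tuple int) : R :=
  gamma (supp k) `^ lambda *
  \prod_(j < d | tnth k j != 0) `|(tnth k j)%:~R| `^ (- (alpha * lambda)).

Lemma weight_ge0 (d : nat) (k : d.-tuple int) : 0 <= weight k.
Proof. by rewrite mulr_ge0 ?powR_ge0// prodr_ge0// => j _; rewrite powR_ge0. Qed.

Variables (d : nat) (K : nat).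
Local Notation FF := {ffun 'I_d -> 'I_(K + K).+1}.

(** The indices 0, ..., 2K stand for the components -K, ..., K. The box then becomes a finite
    function type, where a sum of products is a product of sums. *)
Let iota_ (i : 'I_(K + K).+1) : int := i%:Z - K%:Z.

Let tup (g : FF) : d.-tuple int := [tuple iota_ (g j) | j < d].

Let G (i : 'I_(K + K).+1) : R :=
  if iota_ i != 0 then `|(iota_ i)%:~R| `^ (- (alpha * lambda)) else 0.

(** The negative and the positive components each give one partial sum of the zeta series. *)
Let sum_G : \sum_i G i <= 2 * zeta (alpha * lambda).
Proof.
pose F (i : nat) : R :=
  if i%:Z - K%:Z != 0 then `|(i%:Z - K%:Z)%:~R| `^ (- (alpha * lambda)) else 0.
have -> : \sum_i G i = \sum_(0 <= i < (K + K).+1) F i by rewrite big_mkord.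
have HZ := zeta_ge_partial al1 K.
rewrite (@big_cat_nat _ _ _ K)//=; last by rewrite ltnW// ltnS leq_addr.
rewrite [X in _ + X]big_ltn; last by rewrite ltnS leq_addr.
have -> : F K = 0 by rewrite /F subrr eqxx.
rewrite add0r mulr_natl mulr2n; apply: lerD; apply: le_trans HZ.
  rewrite big_nat_rev add0n big_add1 /= le_eqVlt; apply/orP; left; apply/eqP.
  apply: eq_big_nat => i /= iK; rewrite /F.
  have -> : (K - i.+1)%N%:Z - K%:Z = - (i.+1)%:Z by lia.
  by rewrite oppr_eq0 intrN normrN ger0_norm.
rewrite -[X in \sum_(X <= _ < _) _](add1n K) big_addn -addSn addnK le_eqVlt.
apply/orP; left; apply/eqP.
apply: eq_big_nat => i /andP[i1 iK]; rewrite /F.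
have -> : (i + K)%N%:Z - K%:Z = i%:Z by lia.
by rewrite eqz_nat -lt0n i1 ger0_norm.
Qed.

Let fs (u : {set 'I_d}) : {fset nat} := [fset val j | j in u]%fset.

Let supp_tup (g : FF) : supp (tup g) = fs [set j | iota_ (g j) != 0]%SET.
Proof.
apply/fsetP => m; apply/imfsetP/imfsetP => -[j /= Hj ->]; exists j => //.
  by move: Hj; rewrite !inE tnth_mktuple.
by move: Hj; rewrite !inE tnth_mktuple.
Qed.

(** For fixed [u], the product of these over [j] is the product part of the weight when the support
    is exactly [u], and 0 otherwise, because [G] vanishes at the zero component. *)
Let H (u : {set 'I_d}) (j : 'I_d) (i : 'I_(K + K).+1) : R :=
  if j \in u then G i else (iota_ i == 0)%:R.

Let G_ge0 i : 0 <= G i.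
Proof. by rewrite /G; case: ifP => // _; exact: powR_ge0. Qed.

Let H_ge0 u j i : 0 <= H u j i.
Proof. by rewrite /H; case: ifP. Qed.

Let weight_tup_le (g : FF) :
  weight (tup g) <= \sum_(u : {set 'I_d}) gamma (fs u) `^ lambda * \prod_j H u j (g j).
Proof.
rewrite (bigD1 [set j | iota_ (g j) != 0]%SET)//= -[leLHS]addr0; apply: lerD.
  rewrite /weight supp_tup le_eqVlt; apply/orP; left; apply/eqP; congr (_ * _).
  rewrite big_mkcond; apply: eq_bigr => j _; rewrite /H inE tnth_mktuple /G.
  by case: eqVneq.
apply: sumr_ge0 => u _; rewrite mulr_ge0 ?powR_ge0//.
by apply: prodr_ge0.
Qed.

Let sum_H (u : {set 'I_d}) (j : 'I_d) :
  \sum_i H u j i <= (if j \in u then 2 * zeta (alpha * lambda) else 1).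
Proof.
rewrite /H; case: ifP => _; first exact: sum_G.
have KK : (K < (K + K).+1)%N by rewrite ltnS leq_addr.
rewrite (bigD1 (Ordinal KK))//= big1 ?addr0.
  by rewrite /iota_ /= subrr eqxx.
move=> i; rewrite -val_eqE /= => iK; rewrite /iota_ subr_eq0 eqz_nat.
by rewrite (negbTE iK).
Qed.

Let sum_weight_tup : \sum_(g : FF) weight (tup g) <=
  \sum_(u : {set 'I_d}) gamma (fs u) `^ lambda * (2 * zeta (alpha * lambda)) ^+ #|u|.
Proof.
apply: (le_trans (ler_sum _ (fun g _ => weight_tup_le g))).
rewrite exchange_big /=; apply: ler_sum => u _; rewrite -mulr_sumr.
apply: ler_wpM2l; first exact: powR_ge0.
rewrite -(bigA_distr_bigA (H u)).
apply: (@le_trans _ _ (\prod_j (if j \in u then 2 * zeta (alpha * lambda) else 1))).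
  by apply: ler_prod => j _; rewrite sum_H sumr_ge0.
by rewrite -big_mkcond prodr_const.
Qed.

Lemma weight_sum_box (B : seq (d.-tuple int)) : uniq B ->
  (forall k j, k \in B -> (`|tnth k j| <= K)%N) ->
  ((\sum_(k <- B) weight k)%:E <=
   \esum_(u in [set: {fset nat}])
     (gamma u `^ lambda * (2 * zeta (alpha * lambda)) ^+ #|` u|)%:E)%E.
Proof.
move=> uB BK.
pose gk (k : d.-tuple int) : FF := [ffun j => inord (absz (tnth k j + K%:Z))].
have gkK k : k \in B -> tup (gk k) = k.
  move=> kB; apply: eq_from_tnth => j; rewrite tnth_mktuple /iota_ ffunE.
  have Hm (m : int) : (`|m| <= K)%N -> (absz (m + K%:Z)%R < (K + K).+1)%N by lia.
  by rewrite inordK ?Hm ?BK//; have := BK k j kB; set m : int := tnth k j; lia.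
have E : \sum_(k <- B) weight k <= \sum_(g : FF) weight (tup g).
  have -> : \sum_(k <- B) weight k = \sum_(g <- map gk B) weight (tup g).
    by rewrite big_map; apply: eq_big_seq => k kB; rewrite gkK.
  rewrite big_uniq /=; last first.
    by rewrite map_inj_in_uniq// => k k' kB k'B E; rewrite -(gkK k)// E gkK.
  rewrite [leRHS](bigID (mem (map gk B)))/= lerDl.
  by apply: sumr_ge0 => g _; exact: weight_ge0.
apply: (@le_trans _ _ (\sum_(u : {set 'I_d})
    gamma (fs u) `^ lambda * (2 * zeta (alpha * lambda)) ^+ #|u|)%:E).
  by rewrite lee_fin (le_trans E)// sum_weight_tup.
(* Distinct sets of coordinates are distinct finite sets of naturals, so the finite sum is part of
   the full series: hence a bound independent of [d]. *)
have fs_inj : injective fs.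
  move=> u v uv; apply/setP => j.
  have mem_fs (w : {set 'I_d}) : (val j \in fs w) = (j \in w).
    by rewrite /fs mem_imfset//; exact: val_inj.
  by rewrite -!mem_fs uv.
have ufs : uniq (map fs (index_enum {set 'I_d})).
  by rewrite map_inj_uniq// index_enum_uniq.
apply: le_trans (sum_le_esum _ ufs _); last by [].
rewrite big_map -sumEFin le_eqVlt; apply/orP; left; apply/eqP.
apply: eq_bigr => u _; rewrite /fs card_imfset//=; last exact: val_inj.
by rewrite -cardE.
Qed.

End WeightSum.

(** * Heavy frequencies and the tail of the Fourier coefficients *)

Section Tail.
Context {R : realType}.
Variables (alpha lambda : R) (gamma : {fset nat} -> R) (S : R).
Hypothesis gamma_ge0 : forall u, 0 <= gamma u.
Hypothesis lambda0 : 0 < lambda.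
Hypothesis lambda2 : lambda < 2.
Hypothesis al1 : 1 < alpha * lambda.
Hypothesis sumS : (\esum_(u in [set: {fset nat}])
  (gamma u `^ lambda * (2 * zeta (alpha * lambda)) ^+ #|` u|)%:E = S%:E)%E.

Local Notation w := (weight alpha lambda gamma).

Lemma weight_sum (d : nat) (B : seq (d.-tuple int)) : uniq B ->
  \sum_(k <- B) w k <= S.
Proof.
move=> uB; rewrite -lee_fin -sumS.
(* Every finite list lies in some box; the total of all moduli of components is a convenient
   half-side. *)
apply: (@weight_sum_box _ _ _ _ al1 _ (\sum_(k <- B) \sum_j absz (tnth k j))%N _ uB).
move=> k j kB; rewrite (big_rem k)//= (bigD1 j)//= -addnA; exact: leq_addr.
Qed.

Lemma gamma_powR_le (u : {fset nat}) : gamma u `^ lambda <= S.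
Proof.
have Z1 : 1 <= 2 * zeta (alpha * lambda).
  have := zeta_ge1 al1; lra.
apply: (@le_trans _ _ (gamma u `^ lambda * (2 * zeta (alpha * lambda)) ^+ #|` u|)).
  by rewrite ler_peMr ?powR_ge0// exprn_ege1.
have := @sum_le_esum _ _ [set: {fset nat}]
  (fun u => (gamma u `^ lambda * (2 * zeta (alpha * lambda)) ^+ #|` u|)%:E)
  [:: u] isT (fun _ _ => I).
by rewrite sumS big_seq1 lee_fin.
Qed.

Variable delta : R.
Hypothesis delta0 : 0 < delta.

(** All factors of the product are at most 1, and the one at [j] is at most 1/|k_j| since
    [alpha * lambda > 1]; hence the weight is at most S/|k_j|. *)
Lemma weight_coord_le (d : nat) (k : d.-tuple int) (j : 'I_d) :
  delta <= w k -> (absz (tnth k j))%:R <= S / delta.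
Proof.
move=> dk.
have S0 : 0 <= S by apply: le_trans (gamma_powR_le fset0); exact: powR_ge0.
have [kj|kj] := eqVneq (tnth k j) 0.
  by rewrite kj /= divr_ge0// ltW.
have nk (i : 'I_d) : tnth k i != 0 -> 1 <= `|(tnth k i)%:~R : R|.
  by move=> ki; rewrite -intr_norm -[1]/(1%:~R) ler_int; lia.
rewrite ler_pdivlMr// mulrC -ler_pdivlMr; last by rewrite ltr0n absz_gt0.
apply: (le_trans dk); rewrite /weight.
apply: ler_pM; rewrite ?powR_ge0 ?gamma_powR_le ?prodr_ge0//.
rewrite (bigD1 j)//= -[leRHS]mulr1; apply: ler_pM; rewrite ?powR_ge0 ?prodr_ge0//.
  rewrite powRN lef_pV2 ?posrE ?powR_gt0 ?ltr0n ?absz_gt0//.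
    by rewrite natr_absz intr_norm le1r_powR ?nk// ltW.
  by rewrite normr_gt0 intr_eq0.
apply: prodr_ile1 => i /andP[ki _]; rewrite powR_ge0 powRN invf_le1.
  by rewrite (le_trans (nk i ki))// le1r_powR ?nk// ltW.
by rewrite powR_gt0// normr_gt0 intr_eq0.
Qed.

(* A longest list of distinct frequencies of weight at least [delta] contains
   them all. *)
Lemma exists_heavy (d : nat) : exists A : seq (d.-tuple int),
  [/\ uniq A, forall k, (k \in A) = (delta <= w k) & (size A)%:R <= S / delta].
Proof.
have bound (s : seq (d.-tuple int)) : uniq s -> (forall k, k \in s -> delta <= w k) ->
    (size s)%:R <= S / delta.
  move=> us ws; rewrite ler_pdivlMr//; apply: (le_trans _ (weight_sum us)).
  rewrite -sum1_size natr_sum mulr_suml big_seq [leRHS]big_seq.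
  by apply: ler_sum => k ks; rewrite mul1r ws.
pose P n := `[< exists s : seq (d.-tuple int),
  [/\ uniq s, forall k, k \in s -> delta <= w k & size s = n] >].
have exP : exists n, P n by exists 0%N; apply/asboolP; exists [::].
have ubP n : P n -> (n <= Num.truncn (S / delta))%N.
  by move=> /asboolP[s [us ws <-]]; rewrite truncn_ge_nat ?bound// (le_trans _ (bound s us ws)).
case: (ex_maxnP exP ubP) => n /asboolP[s [us ws sn]] maxn.
exists s; split=> [//|k|]; last exact: bound.
apply/idP/idP => [/ws//|wk]; apply: contraT => ks.
have /maxn : P n.+1; last by rewrite ltnn.
apply/asboolP; exists (k :: s); split; rewrite /= ?ks ?sn//.
by move=> l; rewrite inE => /predU1P[->//|/ws].
Qed.

(** The real value of [korobov_r] for nonzero [gamma (supp k)]. It would be 0 rather than infinite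
    elsewhere, so it is used only on such frequencies. *)
Definition korobov_freq_weight (d : nat) (k : d.-tuple int) : R :=
  (gamma (supp k))^-1 * \prod_(j < d | tnth k j != 0) `|(tnth k j)%:~R| `^ alpha.

Local Notation r := korobov_freq_weight.

Lemma korobov_ball_sum (d : nat) (f : d.-tuple R -> R[i]) (s : seq (d.-tuple int)) :
  korobov_ball alpha gamma d f -> uniq s ->
  (forall k, k \in s -> gamma (supp k) != 0) ->
  \sum_(k <- s) (r k * Normc.normc (fourier_coef f k)) ^+ 2 <= 1.
Proof.
move=> [_ f1] us gs.
have X1 : (\esum_(k in [set k : d.-tuple int | gamma (supp k) != 0%R])
           (korobov_r alpha gamma k ^+ 2 *
            (Normc.normc (fourier_coef f k) ^+ 2)%:E) <= 1)%E.
  move: f1; rewrite /korobov_norm; set X := esum _ _.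
  have X0 : (0 <= X)%E.
    apply: esum_ge0 => k gk; rewrite /korobov_r (negbTE (gk : gamma (supp k) != 0)).
    rewrite -EFin_expe -EFinM.
    by rewrite lee_fin mulr_ge0// ?sqr_ge0.
  move: X X0 => [x|//|//] /=; rewrite !lee_fin => x0 x1.
  by rewrite -(sqr_sqrtr x0) -(expr1n _ 2) lerXn2r ?nnegrE ?sqrtr_ge0.
rewrite -lee_fin; apply: le_trans X1; apply: le_trans (sum_le_esum _ us _); last exact: gs.
rewrite -sumEFin big_seq [leRHS]big_seq.
apply: lee_sum => k ks; rewrite /korobov_r (negbTE (gs k ks)).
by rewrite -EFin_expe -EFinM exprMn.
Qed.

(** With y = 1/r one has w = y^lambda, hence r^(-2) = w^(2/lambda). One factor w is split off to be
    summed; the remaining power is bounded on the tail. *)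
Lemma korobov_freq_weightE (d : nat) (k : d.-tuple int) : gamma (supp k) != 0 ->
  0 < r k /\ r k ^- 2 = w k * w k `^ (2 / lambda - 1).
Proof.
move=> gk; have g0 : 0 < gamma (supp k) by rewrite lt_def gk gamma_ge0.
pose p : R := \prod_(j < d | tnth k j != 0) `|(tnth k j)%:~R|.
have p0 : 0 < p by apply: prodr_gt0 => j kj; rewrite normr_gt0 intr_eq0.
have prodE (a : R) : \prod_(j < d | tnth k j != 0) `|(tnth k j)%:~R| `^ a = p `^ a.
  suff [] : \prod_(j < d | tnth k j != 0) `|(tnth k j)%:~R : R| `^ a = p `^ a /\ 0 <= p by [].
  rewrite /p; elim/big_rec2: _ => [|j x y _ [-> y0]]; first by rewrite powR1.
  by rewrite powRM// mulr_ge0.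
have wE : w k = (gamma (supp k) * p `^ (- alpha)) `^ lambda.
  by rewrite /weight prodE powRM ?powR_ge0// -powRrM mulNr.
have rE : r k = (gamma (supp k) * p `^ (- alpha))^-1.
  by rewrite /korobov_freq_weight prodE invfM powRN invrK.
set y := gamma (supp k) * p `^ (- alpha) in wE rE.
have y0 : 0 < y by rewrite mulr_gt0// powR_gt0.
rewrite rE invr_gt0 y0; split=> //.
rewrite exprVn invrK wE -[X in X * _]powRr1 ?powR_ge0// -powRD; last first.
  by apply/implyP => _; rewrite gt_eqF// powR_gt0.
by rewrite addrC subrK -powRrM mulrCA mulfV ?gt_eqF// mulr1 powR_mulrn// ltW.
Qed.

(* [2 a <= eta r^2 a^2 + 1 / (eta r^2)] avoids the square roots of the
   Cauchy-Schwarz inequality. *)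
Lemma fourier_tail (d : nat) (f : d.-tuple R -> R[i]) (s : seq (d.-tuple int)) (eta : R) :
  korobov_ball alpha gamma d f -> uniq s -> (forall k, k \in s -> w k < delta) ->
  0 < eta ->
  \sum_(k <- s) Normc.normc (fourier_coef f k) <=
    (eta + eta^-1 * (S * delta `^ (2 / lambda - 1))) / 2.
Proof.
move=> bf us ws eta0; set q := 2 / lambda - 1.
have q0 : 0 <= q by rewrite subr_ge0 ler_pdivlMr// mul1r ltW.
(* Where [gamma (supp k)] is zero the coefficient vanishes by definition of the space; these
   frequencies are dropped before dividing by r. *)
pose t := [seq k <- s | gamma (supp k) != 0].
have ut : uniq t by exact: filter_uniq.
have gt k : k \in t -> gamma (supp k) != 0 by rewrite mem_filter => /andP[].
have -> : \sum_(k <- s) Normc.normc (fourier_coef f k) =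
    \sum_(k <- t) Normc.normc (fourier_coef f k).
  rewrite big_filter [RHS]big_mkcond; apply: eq_bigr => k _; case: eqVneq => // g0.
  by case: bf => -[_ _ H _] _; rewrite H// Normc.normc0.
have kS := korobov_ball_sum bf ut gt.
have rS : \sum_(k <- t) r k ^- 2 <= S * delta `^ q.
  apply: (@le_trans _ _ (\sum_(k <- t) w k * delta `^ q)).
    rewrite big_seq [leRHS]big_seq; apply: ler_sum => k kt.
    have [_ ->] := korobov_freq_weightE (gt k kt).
    rewrite ler_wpM2l ?weight_ge0// ge0_ler_powR ?nnegrE ?weight_ge0 ?(ltW delta0)//.
    by rewrite ltW// ws//; move: kt; rewrite mem_filter => /andP[].
  by rewrite -mulr_suml ler_wpM2r ?powR_ge0// weight_sum.
apply: (@le_trans _ _ ((eta * (\sum_(k <- t) (r k * Normc.normc (fourier_coef f k)) ^+ 2) +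
   eta^-1 * \sum_(k <- t) r k ^- 2) / 2)); last first.
  rewrite ler_pM2r ?invr_gt0//; apply: lerD.
    by rewrite -[leRHS]mulr1 ler_pM2l.
  by rewrite ler_pM2l// invr_gt0.
rewrite !mulr_sumr -big_split mulr_suml big_seq [leRHS]big_seq.
apply: ler_sum => k kt; have [r0 _] := korobov_freq_weightE (gt k kt).
move: (Normc.normc (fourier_coef f k)) => a; cbv beta; rewrite ler_pdivlMr// -subr_ge0.
have -> : eta * (r k * a) ^+ 2 + eta^-1 * r k ^- 2 - a * 2 =
    eta * (r k * a - (eta * r k)^-1) ^+ 2.
  by field; rewrite !gt_eqF.
by rewrite mulr_ge0 ?sqr_ge0// ltW.
Qed.

End Tail.

(** * Error and cost of the lattice algorithm *)

Section LatticeError.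
Context {R : realType}.
Local Notation normc := Normc.normc.

Lemma normc_ge0 (a : R[i]) : 0 <= normc a.
Proof. by case: a => a b; exact: sqrtr_ge0. Qed.

(** Both [f x] and the reconstruction depend on [f] at only [N + 1] points, so one Fejer mean close
    to [f] at these points replaces it. *)
Lemma lattice_error (d N : nat) (z : 'I_d -> nat) (A : seq (d.-tuple int))
    (f : d.-tuple R -> R[i]) (tau : R) (x : d.-tuple R) :
  (0 < N)%N -> uniq A ->
  (forall k k', k \in A -> k' \in A -> k != k' ->
    ~~ (N %| \sum_(j < d) (tnth k j - tnth k' j) * (z j)%:Z)%Z) ->
  continuous_tuple f -> periodic1 f ->
  (forall s, uniq s -> (forall k, k \in s -> k \notin A) ->
    \sum_(k <- s) normc (fourier_coef f k) <= tau) ->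
  unit_cube d x ->
  normc (f x - lattice_reconstruct z A (fun i : 'I_N => f (lattice_node z i)) x) <= 2 * tau.
Proof.
move=> N0 uA Hz cf pf Htau Ux; apply/ler_addgt0Pr => e e0.
(* The error at [x] counts once and the errors at the nodes [size A] times, which adds up to [e]. *)
pose e' := e / (1 + (size A)%:R).
have sA : 0 < 1 + (size A)%:R :> R by rewrite ltr_wpDr.
have e'0 : 0 < e' by rewrite divr_gt0.
have [mx Hx] := fejer_mean_cvg cf pf Ux e'0.
have [m Hm] := fin_all_exists (fun i : 'I_N =>
  fejer_mean_cvg cf pf (lattice_node_in_cube z N0 i) e'0).
have [n nE] : exists n, n = (mx + \sum_i m i)%N.+1 by eexists.
have {}Hx : normc (fejer_mean f n x - f x) <= e' by apply: Hx; rewrite nE ltnS leq_addr.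
have {}Hm (i : 'I_N) : normc (fejer_mean f n (lattice_node z i) - f (lattice_node z i)) <= e'.
  apply: (Hm i n); rewrite nE ltnS; apply: leq_trans (leq_addl _ _).
  by rewrite (bigD1 i) //; exact: leq_addr.
have n1 : (0 < n)%N by rewrite nE.
move: Hx Hm n1; clear nE => Hx Hm n1.
pose c (p : {ffun 'I_d -> 'I_n} * {ffun 'I_d -> 'I_n}) : R[i] :=
  ((n%:R ^+ d)^-1)%:C%C * fourier_coef f (freqdiff p).
have FE y : fejer_mean f n y = \sum_p c p * expi (phase (freqdiff p) y).
  by rewrite /fejer_mean; apply: eq_bigr => p _; rewrite mulrA.
have n0 : 0 < n%:R ^+ d :> R by rewrite exprn_gt0 ?ltr0n.
have cS : \sum_(p | freqdiff p \notin A) normc (c p) <= tau.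
  have cE p : normc (c p) = (n%:R ^+ d)^-1 * normc (fourier_coef f (freqdiff p)).
    rewrite /c Normc.normcM; congr (_ * _).
    by rewrite /= expr0n /= addr0 sqrtr_sqr ger0_norm// invr_ge0 ltW.
  under eq_bigr do rewrite cE.
  rewrite -mulr_sumr ler_pdivrMl//.
  rewrite (eq_bigl (fun p : {ffun 'I_d -> 'I_n} * {ffun 'I_d -> 'I_n} =>
     true && (freqdiff (p.1, p.2) \notin A))); last by case.
  rewrite (eq_bigr (fun p => normc (fourier_coef f (freqdiff (p.1, p.2))))); last by case.
  rewrite -(pair_big_dep xpredT (fun a b => freqdiff (a, b) \notin A)
    (fun a b => normc (fourier_coef f (freqdiff (a, b))))).
  (* For each fixed [a] the frequencies a - b are distinct and the tail hypothesis applies; the n^d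
     choices of [a] cancel the normalization. *)
  apply: (@le_trans _ _ (\sum_(a : {ffun 'I_d -> 'I_n}) tau)); last first.
    by rewrite sumr_const card_ffun !card_ord -natrX mulr_natl.
  apply: ler_sum => a _.
  pose s := [seq freqdiff (a, b) |
    b : {ffun 'I_d -> 'I_n} <- index_enum _ & freqdiff (a, b) \notin A].
  have us : uniq s.
    rewrite map_inj_uniq ?filter_uniq ?index_enum_uniq// => b b' E.
    apply/ffunP => j; have /(congr1 (fun t => tnth t j)) := E.
    by rewrite !tnth_mktuple => /addrI/oppr_inj[] /val_inj.
  have sA' k : k \in s -> k \notin A by move=> /mapP[b]; rewrite mem_filter => /andP[bA _] ->.
  by apply: le_trans (Htau s us sA'); rewrite /s big_map big_filter.
have -> : f x - lattice_reconstruct z A (fun i : 'I_N => f (lattice_node z i)) x =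
   (f x - fejer_mean f n x) +
   ((\sum_p c p * expi (phase (freqdiff p) x) - lattice_reconstruct z A
      (fun i : 'I_N => \sum_p c p * expi (phase (freqdiff p) (lattice_node z i))) x) +
   (lattice_reconstruct z A
      (fun i : 'I_N => \sum_p c p * expi (phase (freqdiff p) (lattice_node z i))) x -
   lattice_reconstruct z A (fun i : 'I_N => f (lattice_node z i)) x)).
  by rewrite -FE !addrA !subrK.
have H1 : normc (f x - fejer_mean f n x) <= e' by rewrite -opprB normcN.
have H2 := normc_lattice_error_sum N0 uA Hz
  (index_enum ({ffun 'I_d -> 'I_n} * {ffun 'I_d -> 'I_n})%type)
  c (fun p => freqdiff p) x.
have H3 : normc (lattice_reconstruct z A
      (fun i : 'I_N => \sum_p c p * expi (phase (freqdiff p) (lattice_node z i))) x -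
   lattice_reconstruct z A (fun i : 'I_N => f (lattice_node z i)) x) <= (size A)%:R * e'.
  by apply: normc_lattice_reconstructB => // i; rewrite -FE.
have eE : e = e' + (size A)%:R * e' by rewrite /e' -[X in X + _]mul1r -mulrDl mulrC divfK// gt_eqF.
apply: (le_trans (le_normcD _ _)); rewrite [in leRHS]eE [leRHS]addrCA; apply: (lerD H1).
apply: (le_trans (le_normcD _ _)); apply: lerD H3.
by apply: (le_trans H2); rewrite ler_pM2l.
Qed.

End LatticeError.

(** * Choice of the parameters *)

Section Tractability.
Context {R : realType}.
Variables (alpha lambda : R) (gamma : {fset nat} -> R) (S : R).
Hypothesis gamma_ge0 : forall u, 0 <= gamma u.
Hypothesis lambda0 : 0 < lambda.
Hypothesis lambda2 : lambda < 2.
Hypothesis al1 : 1 < alpha * lambda.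
Hypothesis sumS : (\esum_(u in [set: {fset nat}])
  (gamma u `^ lambda * (2 * zeta (alpha * lambda)) ^+ #|` u|)%:E = S%:E)%E.
Hypothesis S1 : 1 <= S.

Let q : R := 2 / lambda - 1.

Let q0 : 0 < q. Proof. by rewrite subr_gt0 ltr_pdivlMr// mul1r. Qed.

Let S0 : 0 < S. Proof. exact: lt_le_trans S1. Qed.

(** The constant of 3 (S / delta)^3 for delta = (eps^2 / (4 S))^(1/q), the power of [eps] being
    collected in the exponent. *)
Definition tractability_constant : R := 3 * (S * (4 * S) `^ q^-1) ^+ 3.

Definition tractability_exponent : R := 2 / q * 3.

(** With n the integer part of [T] there are at most n^2 differences, with components at most 2n in
    modulus. So N = 2 n^3 + 1 suffices, and [1 <= T] absorbs the last 1. *)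
Lemma lattice_of_size (d : nat) (A : seq (d.-tuple int)) (T : R) :
  1 <= T -> (size A)%:R <= T ->
  (forall k j, k \in A -> (absz (tnth k j))%:R <= T) ->
  exists N (z : 'I_d -> nat), [/\ (0 < N)%N, N%:R <= 3 * T ^+ 3 &
    forall k k', k \in A -> k' \in A -> k != k' ->
      ~~ (N %| \sum_(j < d) (tnth k j - tnth k' j) * (z j)%:Z)%Z].
Proof.
move=> T1 sA AT; pose n := Num.truncn T; pose N := (n ^ 2 * (2 * n))%N.+1.
have T0 : 0 <= T by apply: le_trans T1.
have nT : n%:R <= T by rewrite /n truncn_le.
have sAn : (size A <= n)%N by rewrite truncn_ge_nat.
pose sub (p : d.-tuple int * d.-tuple int) : d.-tuple int :=
  [tuple tnth p.1 j - tnth p.2 j | j < d].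
pose prs := [seq p <- [seq (k, k') | k <- A, k' <- A] | p.1 != p.2].
have [|||z Hz] := @lattice_generator d N (2 * n) (map sub prs).
- move=> h /mapP[[k k']]; rewrite mem_filter /= => /andP[kk' _] ->.
  suff : [exists j, tnth k j != tnth k' j].
    by move=> /existsP[j kj]; exists j; rewrite tnth_mktuple subr_eq0.
  apply: contraT => /existsPn H; move: kk'; rewrite (_ : k = k') ?eqxx//.
  by apply: eq_from_tnth => j; apply/eqP; have := H j; rewrite negbK.
- move=> h j /mapP[[k k']]; rewrite mem_filter /= => /andP[_].
  move=> /allpairsP[[l l'] /= [lA l'A [-> ->]]] ->; rewrite tnth_mktuple /=.
  have Hn m : m \in A -> (absz (tnth m j) <= n)%N by move=> mA; rewrite truncn_ge_nat ?AT.
  by have := Hn l lA; have := Hn l' l'A; set a : int := tnth l j; set b : int := tnth l' j; lia.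
- rewrite ltnS leq_mul2r; apply/orP; right; rewrite size_map.
  apply: (@leq_trans (size A * size A)); last by rewrite expnS expn1 leq_mul.
  by rewrite size_filter (leq_trans (count_size _ _))// size_allpairs.
exists N, z; split => //.
  rewrite /N -natr1 !natrM.
  have n3 : n%:R ^+ 3 <= T ^+ 3 by rewrite lerXn2r ?nnegrE.
  have T3 : 1 <= T ^+ 3 by rewrite exprn_ege1.
  have -> : n%:R * n%:R * (2 * n%:R) + 1 = 2 * n%:R ^+ 3 + 1 :> R by ring.
  lra.
move=> k k' kA k'A kk'.
have /Hz : sub (k, k') \in map sub prs.
  apply: map_f; rewrite mem_filter kk' /=; apply/allpairsP; exists (k, k').
  by split.
by under eq_bigr do rewrite tnth_mktuple /=.
Qed.

Lemma exists_lattice (d : nat) (eps : R) : 0 < eps < 1 ->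
  exists N (z : 'I_d -> nat) (A : seq (d.-tuple int)),
  [/\ (0 < N)%N,
      N%:R <= tractability_constant * eps `^ (- tractability_exponent) &
      forall f x, korobov_ball alpha gamma d f -> unit_cube d x ->
        Normc.normc (f x -
          lattice_reconstruct z A (fun i : 'I_N => f (lattice_node z i)) x) <= eps].
Proof.
move=> /andP[eps0 eps1].
(* [delta] solves S delta^q = (eps/2)^2; with eta = eps/2 both terms of the tail bound are then
   equal and the tail is at most eps/2. *)
pose b := (eps / 2) ^+ 2 / S.
have b0 : 0 < b by rewrite divr_gt0// exprn_gt0// divr_gt0.
pose delta := b `^ q^-1.
have delta0 : 0 < delta by exact: powR_gt0.
have dq : S * delta `^ q = (eps / 2) ^+ 2.
  rewrite /delta -powRrM mulVf ?gt_eqF// powRr1 ?ltW// /b mulrC divfK//.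
  by rewrite gt_eqF.
have b1 : b <= 1.
  rewrite ler_pdivrMr// mul1r (le_trans _ S1)// exprn_ile1//; lra.
have delta1 : delta <= 1.
  have qi0 : 0 <= q^-1 by rewrite invr_ge0 ltW.
  have := ge0_ler_powR qi0 (x := b) (y := 1).
  by rewrite powR1; apply; rewrite ?nnegrE// ltW.
have [A [uA HA sA]] := exists_heavy al1 sumS delta0 d.
have T1 : 1 <= S / delta by rewrite ler_pdivlMr// mul1r (le_trans delta1).
have AT k j : k \in A -> (absz (tnth k j))%:R <= S / delta.
  by rewrite HA; exact: weight_coord_le.
have [N [z [N0 NT Hz]]] := lattice_of_size T1 sA AT.
exists N, z, A; split=> //.
  apply: (le_trans NT); rewrite /tractability_constant /tractability_exponent.
  have dE : delta^-1 = (4 * S) `^ q^-1 * eps `^ (- (2 / q)).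
    have -> : delta = ((4 * S) `^ (-1)) `^ q^-1 * (eps `^ 2) `^ q^-1.
      rewrite -powRM ?powR_ge0// powR_inv1 ?powR_mulrn ?mulr_ge0 ?ltW//.
      by rewrite /delta /b; congr (_ `^ _); field; rewrite gt_eqF.
    by rewrite -!powRrM mulN1r !powRN invfM invrK.
  rewrite dE mulrA [in leLHS]exprMn -[(eps `^ _) ^+ 3]powR_mulrn ?powR_ge0//.
  by rewrite -powRrM mulNr mulrA.
move=> f x bf Ux; have [[cf pf _ _] _] := bf.
have := lattice_error (tau := eps / 2) N0 uA Hz cf pf _ Ux.
rewrite mulrCA divff// mulr1; apply => s us sA'.
have ws k : k \in s -> weight alpha lambda gamma k < delta.
  by move=> ks; have := sA' k ks; rewrite HA ltNge.
have e20 : 0 < eps / 2 by rewrite divr_gt0.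
have := fourier_tail gamma_ge0 lambda0 lambda2 al1 sumS delta0 bf us ws e20.
by rewrite -/q dq; congr (_ <= _); field; rewrite gt_eqF.
Qed.

End Tractability.

(** * The lattice algorithm in the deterministic and the randomized model *)

Section Complexity.
Context {R : realType}.
Local Notation normc := Normc.normc.

Lemma measurable_Re_Im_sum (d : nat) (I : Type) (s : seq I) (F : I -> d.-tuple R -> R[i]) :
  (forall i, measurable_fun setT (fun x => complex.Re (F i x)) /\
             measurable_fun setT (fun x => complex.Im (F i x))) ->
  measurable_fun setT (fun x => complex.Re (\sum_(i <- s) F i x)) /\
  measurable_fun setT (fun x => complex.Im (\sum_(i <- s) F i x)).
Proof.
move=> mF; elim: s => [|i s [IH1 IH2]].
  by split; under eq_fun do rewrite big_nil; exact: measurable_cst.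
split.
  have -> : (fun x => complex.Re (\sum_(j <- i :: s) F j x)) =
      (fun x => complex.Re (F i x) + complex.Re (\sum_(j <- s) F j x)).
    by apply/funext => x; rewrite big_cons; case: (F i x); case: (\sum_(j <- s) _).
  by apply: measurable_funD => //; exact: (mF i).1.
have -> : (fun x => complex.Im (\sum_(j <- i :: s) F j x)) =
    (fun x => complex.Im (F i x) + complex.Im (\sum_(j <- s) F j x)).
  by apply/funext => x; rewrite big_cons; case: (F i x); case: (\sum_(j <- s) _).
by apply: measurable_funD => //; exact: (mF i).2.
Qed.

Lemma measurable_lattice_reconstruct (d N : nat) (z : 'I_d -> nat)
    (A : seq (d.-tuple int)) (v : 'I_N -> R[i]) :
  measurable_fun setT (fun x => complex.Re (lattice_reconstruct z A v x)) /\
  measurable_fun setT (fun x => complex.Im (lattice_reconstruct z A v x)).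
Proof.
apply: measurable_Re_Im_sum => k; case: (_ * _) => a b.
have mc : measurable_fun setT (fun x : d.-tuple R => cos (phase k x)).
  exact: (measurableT_comp (continuous_measurable_fun (@continuous_cos R))
    (@measurable_phase R d k)).
have ms : measurable_fun setT (fun x : d.-tuple R => sin (phase k x)).
  exact: (measurableT_comp (continuous_measurable_fun (@continuous_sin R))
    (@measurable_phase R d k)).
by split; [apply: measurable_funB|apply: measurable_funD]; apply: measurable_funM.
Qed.

Definition lattice_algorithm (d N : nat) (z : 'I_d -> nat)
    (A : seq (d.-tuple int)) (N0 : (0 < N)%N) : @det_algorithm R N d :=
  @DetAlgorithm R N d [tuple lattice_node z i | i < N]
    (fun i => eq_ind_r (unit_cube d) (lattice_node_in_cube z N0 i)
       (tnth_mktuple (fun i => lattice_node z i) i))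
    (fun v => lattice_reconstruct z A (fun i => tnth v i)).

Lemma run_lattice_algorithm (d N : nat) (z : 'I_d -> nat)
    (A : seq (d.-tuple int)) (N0 : (0 < N)%N) (f : d.-tuple R -> R[i]) :
  run (lattice_algorithm z A N0) f =
  lattice_reconstruct z A (fun i : 'I_N => f (lattice_node z i)).
Proof.
rewrite /run /=; congr lattice_reconstruct; apply/funext => i.
by rewrite tnth_map tnth_mktuple.
Qed.

Variables (alpha : R) (gamma : {fset nat} -> R).

Lemma measurable_run_lattice_algorithm (d N : nat) (z : 'I_d -> nat)
    (A : seq (d.-tuple int)) (N0 : (0 < N)%N) (f : d.-tuple R -> R[i]) D :
  measurable_fun D (fun x => complex.Re (run (lattice_algorithm z A N0) f x)) /\
  measurable_fun D (fun x => complex.Im (run (lattice_algorithm z A N0) f x)).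
Proof.
have [H1 H2] := measurable_lattice_reconstruct z A (fun i : 'I_N => f (lattice_node z i)).
by rewrite run_lattice_algorithm; split; apply: measurable_funTS.
Qed.

(* [0.-tuple R] serves as a one-point probability space. *)
Definition rand_lattice_algorithm (d N : nat) (z : 'I_d -> nat)
    (A : seq (d.-tuple int)) (N0 : (0 < N)%N) : rand_algorithm alpha gamma N d.
Proof.
apply: (@RandAlgorithm R alpha gamma N d _ (0.-tuple R) (@cube_measure R 0)
  (fun=> lattice_algorithm z A N0)); first exact: measurable_cst.
move=> f _; have [H1 H2] := measurable_run_lattice_algorithm z A N0 f setT.
split; apply: measurable_funTS.
  exact: (measurableT_comp H1 measurable_snd).
exact: (measurableT_comp H2 measurable_snd).
Defined.

End Complexity.

Section Errors.
Context {R : realType}.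
Variables (alpha : R) (gamma : {fset nat} -> R).
Variables (d N : nat) (z : 'I_d -> nat) (A : seq (d.-tuple int)) (N0 : (0 < N)%N).
Variable eps : R.
Hypothesis eps0 : 0 <= eps.
Hypothesis err : forall f x, korobov_ball alpha gamma d f -> unit_cube d x ->
  Normc.normc (f x - run (lattice_algorithm z A N0) f x) <= eps.

Lemma det_Linfty_error_lattice :
  (det_Linfty_error alpha gamma (lattice_algorithm z A N0) <= eps%:E)%E.
Proof.
apply: ge_ereal_sup => _ [f bf <-]; apply: ge_ereal_sup => _ [x Ux <-].
by rewrite lee_fin err.
Qed.

Lemma rand_L2_error_lattice :
  (rand_L2_error (rand_lattice_algorithm alpha gamma z A N0) <= eps%:E)%E.
Proof.
have mU := @measurable_unit_cube R d.
apply: ge_ereal_sup => _ [f bf <-].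
have -> : eps%:E = sqrte (eps ^+ 2)%:E by rewrite /= sqrtr_sqr ger0_norm.
rewrite lee_sqrt ?lee_fin ?sqr_ge0//.
set c : \bar R := (L2_norm (fun x => (f x - run (lattice_algorithm z A N0) f x)%R) ^+ 2)%E.
have cE : (c <= (eps ^+ 2)%:E)%E.
  rewrite /c /L2_norm sqr_sqrte; last first.
    by apply: integral_ge0 => x _; rewrite lee_fin sqr_ge0.
  apply: (@le_trans _ _ (\int[cube_measure d]_(x in unit_cube d) (eps ^+ 2)%:E)%E).
    apply: ge0_le_integral => //.
    - by move=> x _; rewrite lee_fin sqr_ge0.
    (* The error is measurable: [f] is continuous and its reconstruction is a trigonometric
       polynomial. *)
    - apply/measurable_EFinP.
      pose g x := f x - run (lattice_algorithm z A N0) f x.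
      have [[[cf1 cf2] _ _ _] _] := bf.
      have [m1 m2] := measurable_run_lattice_algorithm z A N0 f (unit_cube d).
      have mg1 : measurable_fun (unit_cube d) (fun x => complex.Re (g x)).
        have := measurable_funB (@measurable_continuous_tuple R d
          (fun x => complex.Re (f x)) cf1 (unit_cube d)) m1.
        apply: eq_measurable_fun => x _.
        rewrite -[LHS]/(complex.Re (f x) - complex.Re (run (lattice_algorithm z A N0) f x)) /g.
        by move: (f x) (run (lattice_algorithm z A N0) f x) => [a b] [a' b'].
      have mg2 : measurable_fun (unit_cube d) (fun x => complex.Im (g x)).
        have := measurable_funB (@measurable_continuous_tuple R d
          (fun x => complex.Im (f x)) cf2 (unit_cube d)) m2.
        apply: eq_measurable_fun => x _.
        rewrite -[LHS]/(complex.Im (f x) - complex.Im (run (lattice_algorithm z A N0) f x)) /g.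
        by move: (f x) (run (lattice_algorithm z A N0) f x) => [a b] [a' b'].
      have := measurable_funD (measurable_funX 2 mg1) (measurable_funX 2 mg2).
      apply: eq_measurable_fun => x _.
      rewrite -[LHS]/(complex.Re (g x) ^+ 2 + complex.Im (g x) ^+ 2) -/(g x).
      case: (g x) => a b /=.
      by rewrite sqr_sqrtr// addr_ge0 ?sqr_ge0.
    - move=> x Ux; rewrite lee_fin lerXn2r ?nnegrE ?normc_ge0 ?err//.
  rewrite integral_cst// -[leRHS]mule1; apply: lee_wpmul2l.
    by rewrite lee_fin sqr_ge0.
  exact: probability_le1.
(* The integrand does not depend on the random element, so its expectation is [c]. *)
rewrite [leLHS](_ : _ = c)//.
rewrite integral_cst// [X in (_ * X)%E](_ : _ = 1%E); first by rewrite mule1.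
exact: (probability_setT (cube_measure 0)).
Qed.

End Errors.

Theorem theorem4p10 (R : realType) (alpha : R) (gamma : {fset nat} -> R)
    (halpha : 1 / 2 < alpha)
    (hgamma : forall u : {fset nat}, 0 <= gamma u)
    (hgamma0 : gamma fset0 = 1)
    (hsum : exists lambda : R, [/\ 1 / alpha < lambda, lambda < 2 &
      (\esum_(u in [set: {fset nat}])
         (gamma u `^ lambda * (2 * zeta (alpha * lambda)) ^+ #|` u|)%:E
       < +oo)%E]) :
  strongly_polynomially_tractable (det_Linfty_complexity alpha gamma) /\
  strongly_polynomially_tractable (rand_L2_complexity alpha gamma).
Proof.
have [lambda [lam1 lam2 sum_lty]] := hsum.
have alpha0 : 0 < alpha by apply: lt_trans halpha; rewrite divr_gt0.
have lambda0 : 0 < lambda by apply: lt_trans lam1; rewrite divr_gt0.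
have al1 : 1 < alpha * lambda by rewrite mulrC -ltr_pdivrMr.
move: sum_lty; set E := esum _ _ => E_lty.
have E0 : (0 <= E)%E.
  apply: esum_ge0 => u _; rewrite lee_fin mulr_ge0 ?powR_ge0// exprn_ge0//.
  by rewrite mulr_ge0// (le_trans ler01)// zeta_ge1.
have /fineK/esym sumS : E \is a fin_num by rewrite ge0_fin_numE.
(* The empty set contributes the term 1 to the series. *)
have S1 : 1 <= fine E.
  have := gamma_powR_le al1 sumS fset0.
  by rewrite hgamma0 powR1.
have S0 : 0 < fine E by exact: lt_le_trans S1.
have C0 : 0 < tractability_constant lambda (fine E).
  by rewrite mulr_gt0// exprn_gt0// mulr_gt0// powR_gt0// mulr_gt0.
have p0 : 0 <= tractability_exponent lambda.
  by rewrite mulr_ge0// divr_ge0// subr_ge0 ler_pdivlMr// mul1r ltW.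
split; exists (tractability_constant lambda (fine E)), (tractability_exponent lambda);
  split=> // eps d eps01 _.
  have [N [z [A [N0 NC err]]]] := exists_lattice hgamma lambda0 lam2 al1 sumS S1 d eps01.
  have eps0 : 0 <= eps by move: eps01 => /andP[/ltW].
  apply: (@le_trans _ _ (N%:R)%:E); last by rewrite lee_fin.
  apply: ereal_inf_lbound; exists N => //; exists (lattice_algorithm z A N0).
  apply: det_Linfty_error_lattice => f x bf Ux.
  by rewrite run_lattice_algorithm err.
have [N [z [A [N0 NC err]]]] := exists_lattice hgamma lambda0 lam2 al1 sumS S1 d eps01.
have eps0 : 0 <= eps by move: eps01 => /andP[/ltW].
apply: (@le_trans _ _ (N%:R)%:E); last by rewrite lee_fin.
apply: ereal_inf_lbound; exists N => //.
exists (rand_lattice_algorithm alpha gamma z A N0).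
apply: rand_L2_error_lattice => // f x bf Ux.
by rewrite run_lattice_algorithm err.
Qed.
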